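(* Let $K$ be a $p$-adic field and let $F/K$ be a finite normal tamely ramified split extension with $\zeta_p\in F$, $H=\mathrm{Gal}(F/K)$, $e=e(F/K)$, $f=f(F/K)$ and $q=|\kappa_K|$. Let $\alpha,\beta\in\bar{\mathbb{F}}_p$. Suppose that $\alpha^e=1$ and that $\mathrm{ord}(\alpha)=t$. Let $s=\mathrm{ord}_t^\times(q)$ and $\tilde u=f/s$, and suppose that $\beta^{\tilde u}=1$. Then the multiplicity of $J_{(\alpha,\beta)}$ in $\bar Y$ is equal to $s\cdot[K:\mathbb{Q}_p]$, where $J_{(\alpha,\beta)}$ and $\bar Y$ are defined in the context.
   Context: $\kappa_K,\kappa_F$ are the residue fields; $e_F$ is the absolute ramification index of $F$; $\mathrm{ord}_t^\times(q)$ is the multiplicative order of $q$ modulo $t$. ''Split'' means $H=T\rtimes U$ where $T=\langle\tau\rangle$ is the inertia subgroup (cyclic of order $e$ coprime to $p$) and $U=\langle\upsilon\rangle$ (of order $f$) is a complement generated by a lifting $\upsilon$ of the Frobenius $x\mapsto x^q$; one has $\upsilon\tau\upsilon^{-1}=\tau^q$. Let $\pi$ be a uniformizer of the fixed field $F'$ of $U$ (hence of $F$) which is an $e$-th root of a uniformizer of $K$, and let $\zeta=\tau(\pi)/\pi$, a primitive $e$-th root of unity with image $\bar\zeta\in\kappa_F$. For $i\ge1$, $M_i$ is the $\mathbb{F}_p[H]$-module with underlying set $\kappa_F$ and action $\tau(x)=\bar\zeta^ix$, $\upsilon(x)=x^q$. Put $Y=\bigoplus_i M_i$, the sum over integers $i$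 prime to $p$ in $[0,\frac{pe_F}{p-1}]$, and $\bar Y=Y\otimes_{\mathbb{F}_p}\bar{\mathbb{F}}_p$. For $\alpha,\beta$ as in the claim, let $\tilde U=\langle\upsilon^s\rangle\subseteq U$, of order $\tilde u$ (it is the centralizer in $U$ of the quotient of $T$ of order $t$). $V_{(\alpha,\beta)}$ is the one-dimensional $\bar{\mathbb{F}}_p$-representation of $T\rtimes\tilde U$ on which $\tau$ acts as $\alpha$ and $\upsilon^s$ acts as $\beta$, and $J_{(\alpha,\beta)}=\mathrm{Ind}_{T\rtimes\tilde U}^H(V_{(\alpha,\beta)})$, an irreducible representation. The multiplicity of an irreducible module $J$ in a module $M$ is the largest $m$ such that $M$ contains a submodule isomorphic to $J^m$. *)

(* Defs.v *)
From HB Require Import structures.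
From mathcomp Require Import all_boot all_order all_algebra.
From mathcomp Require Import all_fingroup all_solvable all_field all_character.

Set Implicit Arguments.
Unset Strict Implicit.
Unset Printing Implicit Defensive.

Import Order.TTheory GRing.Theory Num.Theory.
Import GroupScope.
Local Open Scope ring_scope.

(* A discrete valuation is an integer-valued function whose value at 0 is
   junk; [val_ge v n x] reads "v(x) >= n" with the convention v(0) = +oo. *)
Definition val_ge (K : fieldType) (v : K -> int) (n : int) (x : K) : Prop :=
  x = 0 \/ n <= v x.

Definition uniformizer (K : fieldType) (v : K -> int) (x : K) : Prop :=
  x != 0 /\ v x = 1.

(* Normalized: the value group is the whole of Z. *)
Record discrete_valuation (K : fieldType) (v : K -> int) : Prop := {
  dv_mul : forall x y, x != 0 -> y != 0 -> v (x * y) = v x + v y;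
  dv_add : forall n x y, val_ge v n x -> val_ge v n y -> val_ge v n (x + y);
  dv_unif : exists x, uniformizer v x }.

Definition val_complete (K : fieldType) (v : K -> int) : Prop :=
  forall u : nat -> K,
    (forall n : int, exists N : nat, forall i j : nat,
       (N <= i)%N -> (N <= j)%N -> val_ge v n (u i - u j)) ->
    exists l : K, forall n : int, exists N : nat, forall i : nat,
      (N <= i)%N -> val_ge v n (u i - l).

Definition padic_val (p : nat) (r : rat) : int :=
  (logn p `|numq r|)%:Z - (logn p `|denq r|)%:Z.

(* Q_p is the completion of Q for the p-adic valuation: a complete valued field
   in which Q is dense and whose valuation extends the p-adic one.  The
   embedding is a ring morphism, so the characteristic is 0. *)
Record is_padic_completion (p : nat) (Qp : fieldType) (v : Qp -> int) : Prop := {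
  pc_val : discrete_valuation v;
  pc_complete : val_complete v;
  pc_dense : exists iota : {rmorphism rat -> Qp},
    (forall r : rat, r != 0 -> v (iota r) = padic_val p r) /\
    (forall (x : Qp) (n : int), exists r : rat, val_ge v n (x - iota r)) }.

Definition ramification_index (K : fieldType) (L : fieldExtType K)
    (v : K -> int) (w : L -> int) (e : nat) : Prop :=
  forall x : K, x != 0 -> w x%:A = e%:Z * v x.

(* [k] is the residue field of [v], with reduction map [r]; the values of [r]
   outside the valuation ring are junk. *)
Record residue_map (K : fieldType) (v : K -> int) (k : fieldType)
    (r : K -> k) : Prop := {
  rm_one : r 1 = 1;
  rm_add : forall x y, val_ge v 0 x -> val_ge v 0 y -> r (x + y) = r x + r y;
  rm_mul : forall x y, val_ge v 0 x -> val_ge v 0 y -> r (x * y) = r x * r y;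
  rm_surj : forall a, exists2 x, val_ge v 0 x & r x = a;
  rm_ker : forall x, val_ge v 0 x -> (r x = 0 <-> val_ge v 1 x) }.

(* In MathComp (x * y)%g a = y (x a) in the group [gal_of], i.e. the product is
   opposite to the usual composition: left modules over the usual Galois group
   are right modules here, hence matrix representations acting on row vectors,
   and the relation ups o tau o ups^-1 = tau^q reads tau ^ ups = tau ^+ q. *)
Definition is_inertia (K : fieldType) (L : splittingFieldType K) (w : L -> int)
    (k : fieldType) (r : L -> k) (T : {set gal_of {:L}}) : Prop :=
  forall g : gal_of {:L},
    g \in T <-> (forall x : L, val_ge w 0 x -> r (g x) = r x).

Definition lifts_frobenius (K : fieldType) (L : splittingFieldType K)
    (w : L -> int) (k : fieldType) (r : L -> k) (q : nat)
    (g : gal_of {:L}) : Prop :=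
  forall x : L, val_ge w 0 x -> r (g x) = r x ^+ q.

Lemma sub_gal_full (K : fieldType) (L : splittingFieldType K)
    (A : {set gal_of {:L}}) : A \subset 'Gal({:L} / 1).
Proof.
apply/subsetP=> g _; rewrite gal_kHom ?sub1v //.
apply/kAHomP => x /vlineP[a ->]; by rewrite linearZ rmorph1.
Qed.

Definition is_mult_order (t q s : nat) : Prop :=
  [/\ (0 < s)%N, q ^ s = 1 %[mod t] &
      forall m : nat, (0 < m)%N -> q ^ m = 1 %[mod t] -> (s <= m)%N].

(* [rG] is, in some F_p-basis, the F_p[G]-module with underlying set [k] on
   which [tau] acts as x |-> z^i x and [ups] as x |-> x^q.  As [k] has characteristic p,
   additive maps are F_p-linear. *)
Definition affords_M (p : nat) (gT : finGroupType) (G : {group gT})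
    (tau ups : gT) (k : fieldType) (z : k) (q i : nat)
    (rG : representation 'F_p G) : Prop :=
  exists phi : {additive k -> 'rV['F_p]_(rdegree rG)},
    [/\ bijective phi,
        forall x, phi (z ^+ i * x) = phi x *m rG tau &
        forall x, phi (x ^+ q) = phi x *m rG ups].

Definition base_change (R S : fieldType) (f : {rmorphism R -> S})
    (gT : finGroupType) (G : {group gT}) (rG : representation R G) :
  representation S G := Representation (map_repr f rG).

Section Induction.

Variables (R : fieldType) (gT : finGroupType) (A G : {group gT}).
Hypothesis sAG : A \subset G.
Variables (n : nat) (rV : mx_representation R A n).

Definition ind_index : finType := ({B | B \in rcosets A G} * 'I_n)%type.

Definition ind_rep (a : ind_index) : gT := repr (val a.1).

(* The module V (x)_{R[A]} R[G], in the basis e_i (x) x with x ranging over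
   representatives of the right cosets of A in G:
   (e_i (x) x) g = (e_i . (x g y^-1)) (x) y, where A x g = A y. *)
Definition ind_mx (g : gT) : 'M[R]_#|ind_index| :=
  \matrix_(i, j)
    let a := enum_val i in let b := enum_val j in
    let h := (ind_rep a * g * (ind_rep b)^-1)%g in
    if h \in A then rV h a.2 b.2 else 0.

Lemma ind_repK (B : {B | B \in rcosets A G}) : A :* repr (val B) = val B.
Proof. by case: B => B /= /rcosetsP[x _ ->]; exact: rcoset_repr. Qed.

Lemma ind_rep_in (a : ind_index) : ind_rep a \in G.
Proof.
have : ind_rep a \in A :* repr (val a.1) by exact: rcoset_refl.
rewrite ind_repK; case: a.1 => B /= /rcosetsP[x Gx ->].
by case/rcosetP=> y /(subsetP sAG) Gy ->; rewrite groupM.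
Qed.

Lemma ind_mx_repr : mx_repr G ind_mx.
Proof.
split=> [|g h Gg Gh].
  apply/matrixP=> i j; rewrite !mxE /= mulg1 -mem_rcoset.
  have -> : (ind_rep (enum_val i) \in A :* ind_rep (enum_val j))
          = ((enum_val i).1 == (enum_val j).1).
    rewrite /ind_rep -(inj_eq val_inj) -[val (enum_val i).1 in RHS]ind_repK.
    rewrite -[val (enum_val j).1 in RHS]ind_repK.
    by apply/idP/eqP=> [/rcoset_eqP // | <-]; exact: rcoset_refl.
  rewrite -(inj_eq enum_val_inj) -pair_eqE /= /pair_eq /=.
  case: eqP => //= e1; rewrite /ind_rep e1 mulgV repr_mx1 mxE.
  by [].
apply/matrixP=> i j; rewrite !mxE.
rewrite (reindex_onto (@enum_rank ind_index) enum_val) /=; last first.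
  by move=> k _; rewrite enum_valK.
under eq_bigl do rewrite enum_rankK eqxx.
under eq_bigr do rewrite !mxE /= !enum_rankK.
set a := enum_val i; set b := enum_val j.
set x := ind_rep a; set y := ind_rep b.
have Gx : x \in G := ind_rep_in a.
have XC : A :* (x * g) \in rcosets A G by apply/rcosetsP; exists (x * g)%g; rewrite ?groupM.
pose C : {B | B \in rcosets A G} := exist (fun B => B \in rcosets A G) _ XC.
rewrite (eq_bigr (fun c : ind_index => (fun (c1 : {B | B \in rcosets A G}) (c2 : 'I_n) =>
   (let h0 := (x * g * (repr (val c1))^-1)%g in if h0 \in A then rV h0 a.2 c2 else 0) *
   (let h0 := (repr (val c1) * h * y^-1)%g in if h0 \in A then rV h0 c2 b.2 else 0)) c.1 c.2));
  last by [].
rewrite -(pair_bigA _ (fun (c1 : {B | B \in rcosets A G}) (c2 : 'I_n) =>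
   (let h0 := (x * g * (repr (val c1))^-1)%g in if h0 \in A then rV h0 a.2 c2 else 0) *
   (let h0 := (repr (val c1) * h * y^-1)%g in if h0 \in A then rV h0 c2 b.2 else 0))) /=.
rewrite (bigD1 C) //= [X in _ = _ + X]big1 ?addr0; last first.
  move=> c1 neq; apply: big1 => c2 _; case: ifP; rewrite ?mul0r // => Ah.
  case/eqP: neq; apply: val_inj => /=; rewrite -ind_repK.
  by apply/esym/rcoset_eqP; rewrite mem_rcoset.
set z := repr _.
have Az : (x * g * z^-1)%g \in A.
  rewrite -mem_rcoset; apply/rcoset_eqP.
  by rewrite /z rcoset_repr.
rewrite Az.
have -> : (x * (g * h) * y^-1 = (x * g * z^-1) * (z * h * y^-1))%g.
  by rewrite !mulgA mulgKV.
rewrite groupMl //; case: ifP => Ah; last first.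
  by rewrite big1 // => c _; rewrite mulr0.
by rewrite repr_mxM // mxE.
Qed.

Definition ind_repr : representation R G :=
  Representation (MxRepresentation ind_mx_repr).

End Induction.

(* [rG] contains a submodule isomorphic to the direct sum of [m] copies of
   [rJ]. *)
Definition contains_copies (R : fieldType) (gT : finGroupType) (G : {group gT})
    (rG rJ : representation R G) (m : nat) : Prop :=
  exists (U : 'M[R]_(rdegree rG)) (modU : mxmodule rG U),
    mx_rsim (submod_repr modU) (muln_grepr rJ m).

Definition is_multiplicity (R : fieldType) (gT : finGroupType) (G : {group gT})
    (rG rJ : representation R G) (m : nat) : Prop :=
  contains_copies rG rJ m /\
  forall m' : nat, contains_copies rG rJ m' -> (m' <= m)%N.

(* Main.v *)
Require Import Defs.
From HB Require Import structures.
From mathcomp Require Import all_boot all_order all_algebra.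
From mathcomp Require Import all_fingroup all_solvable all_field all_character.
From mathcomp Require Import zify ring.

(* By Frobenius reciprocity the multiplicity of J = J_(alpha, beta) in a module
   is the dimension of the space of joint eigenvectors of tau and ups^s for the
   eigenvalues alpha and beta: these generate copies of J because their
   translates by the powers of ups lie in eigenspaces of tau for the distinct
   eigenvalues alpha^(q^j), j < s.

   After extension of scalars kappa_F becomes a product of copies of the
   closure, indexed by Z/d with p^d = |kappa_F|; on M_i, tau multiplies the
   coordinate l by zeta^(i p^l), and ups^s shifts the coordinates by D, where
   p^D = q^s.  The shift acts freely, so M_i contributes the number of l < D
   such that zeta^(i p^l) = alpha, even when p divides the order of ups.

   If e_F = (p - 1) m, the sum over the i <= p m prime to p of these numbers
   telescopes, because the multiples i = p j at level l cancel the j <= m at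
   level l + 1.  What remains is a count over m < i <= p m, an interval of
   (p - 1) m = e e_K integers, so each l < D contributes e_K; and D e_K =
   s [K : Q_p] by the fundamental identity [L : Q_p] = e_L f_L, which follows
   from p-adic expansions and, applied to F, also gives |T| = e. *)

Set Implicit Arguments.
Unset Strict Implicit.
Unset Printing Implicit Defensive.

Import Order.TTheory GRing.Theory Num.Theory.
Local Open Scope ring_scope.

(** * Discrete valuations *)

Section Valuation.

Variables (K : fieldType) (v : K -> int).
Hypothesis hv : discrete_valuation v.
Implicit Types x y : K.

Lemma val_one : v 1 = 0.
Proof.
by apply: (addrI (v 1)); rewrite -(dv_mul hv) ?oner_eq0 // mul1r addr0.
Qed.

Lemma valN x : v (- x) = v x.
Proof.
have [->|nz_x] := eqVneq x 0; first by rewrite oppr0.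
have vN1: v (-1) + v (-1) = 0.
  by rewrite -(dv_mul hv) ?oppr_eq0 ?oner_eq0 // mulrNN mulr1 val_one.
by rewrite -mulN1r (dv_mul hv) ?oppr_eq0 ?oner_eq0 //; lia.
Qed.

Lemma valV x : x != 0 -> v x^-1 = - v x.
Proof.
move=> nz_x; have: v x + v x^-1 = 0.
  by rewrite -(dv_mul hv) ?invr_eq0 // mulfV // val_one.
lia.
Qed.

Lemma valX x n : x != 0 -> v (x ^+ n) = n%:Z * v x.
Proof.
move=> nz_x; elim: n => [|n IHn]; first by rewrite val_one; lia.
by rewrite exprS (dv_mul hv) ?expf_neq0 // IHn; lia.
Qed.

Lemma val_ge0 n : val_ge v n 0. Proof. by left. Qed.

Lemma val_ge1 : val_ge v 0 1. Proof. by right; rewrite val_one. Qed.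

Lemma val_ge_leq m n x : m <= n -> val_ge v n x -> val_ge v m x.
Proof. by move=> le_mn [->|le_nx]; [left | right; exact: le_trans le_nx]. Qed.

Lemma val_geN n x : val_ge v n x -> val_ge v n (- x).
Proof. by case=> [->|]; [rewrite oppr0; left | rewrite -valN; right]. Qed.

Lemma val_geD n x y : val_ge v n x -> val_ge v n y -> val_ge v n (x + y).
Proof. exact: dv_add. Qed.

Lemma val_geB n x y : val_ge v n x -> val_ge v n y -> val_ge v n (x - y).
Proof. by move=> vx /val_geN; exact: val_geD. Qed.

Lemma val_ge_subC n x y : val_ge v n (x - y) -> val_ge v n (y - x).
Proof. by move/val_geN; rewrite opprB. Qed.

Lemma val_geM m n x y :
  val_ge v m x -> val_ge v n y -> val_ge v (m + n) (x * y).
Proof.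
have [->|nz_x] := eqVneq x 0; first by rewrite mul0r; left.
have [->|nz_y] := eqVneq y 0; first by rewrite mulr0; left.
case=> [x0|vx]; first by rewrite x0 eqxx in nz_x.
case=> [y0|vy]; first by rewrite y0 eqxx in nz_y.
by right; rewrite (dv_mul hv) //; exact: lerD.
Qed.

Lemma val_geM0 x y : val_ge v 0 x -> val_ge v 0 y -> val_ge v 0 (x * y).
Proof. by move=> vx vy; rewrite -[0]addr0; exact: val_geM. Qed.

Lemma val_geX x n : val_ge v 0 x -> val_ge v 0 (x ^+ n).
Proof.
move=> vx; elim: n => [|n IHn]; first exact: val_ge1.
by rewrite exprS; exact: val_geM0.
Qed.

Lemma val_ge_sum (I : Type) (r : seq I) (P : pred I) (F : I -> K) n :
  (forall i, P i -> val_ge v n (F i)) -> val_ge v n (\sum_(i <- r | P i) F i).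
Proof.
by move=> vF; elim/big_ind: _ => //; [left | exact: val_geD].
Qed.

Lemma val_ge_nat n : val_ge v 0 n%:R.
Proof. 
elim: n => [|n IHn]; first by left.
by rewrite -natr1; exact: val_geD IHn val_ge1.
Qed.

Lemma val_geE n x : x != 0 -> val_ge v n x <-> n <= v x.
Proof.
by move=> nz_x; split=> [[x0|]|]; [rewrite x0 eqxx in nz_x | | right].
Qed.

(** Separatedness of the valuation topology: an identity may be checked modulo every power of the
    maximal ideal. *)
Lemma val_ge_all x : (forall n : nat, val_ge v n%:Z x) -> x = 0.
Proof.
move=> vx; have [//|nz_x] := eqVneq x 0.
by have /(val_geE _ nz_x) := vx (absz (v x)).+1; lia.
Qed.

Lemma val_ge_mull m n x y :
  y != 0 -> v y = m -> val_ge v (m + n) (y * x) <-> val_ge v n x.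
Proof.
move=> nz_y <-; split=> [|vx]; last by apply: val_geM; [right | ].
have [->|nz_x] := eqVneq x 0; first by left.
by rewrite val_geE ?mulf_neq0 // (dv_mul hv) // lerD2l => vx; right.
Qed.

Lemma unif_val_geX (varpi : K) n : uniformizer v varpi -> val_ge v n%:Z (varpi ^+ n).
Proof. by case=> nz vw; right; rewrite valX // vw mulr1. Qed.

Lemma val_unitP x :
  x != 0 -> v x = 0 <-> val_ge v 0 x /\ val_ge v 0 x^-1.
Proof.
move=> nz_x; rewrite !val_geE ?invr_eq0 // valV //; split; last lia.
by move=> ->; rewrite oppr0.
Qed.

(** A strictly dominant term decides the valuation: otherwise [x = (x + y) - y] would have valuation
    at least [n + 1]. *)
Lemma val_add_eq x y n :
  x != 0 -> v x = n -> val_ge v (n + 1) y -> x + y != 0 /\ v (x + y) = n.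
Proof.
move=> nz_x vx vy.
have vx1 m : val_ge v m x -> m <= n by move/(val_geE _ nz_x); rewrite vx.
have nz : x + y != 0.
  apply/negP=> /eqP/(canRL (addrK y)); rewrite add0r => xE.
  by have := vx1 (n + 1); rewrite xE => /(_ (val_geN vy)); lia.
split=> //; apply/eqP; rewrite eq_le; apply/andP; split; last first.
  apply/(val_geE _ nz)/val_geD; first by right; rewrite vx.
  by apply: val_ge_leq vy; lia.
rewrite leNgt; apply/negP=> lt_n; have := vx1 (n + 1).
have -> : x = (x + y) - y by rewrite addrK.
have vxn : val_ge v (n + 1) (x + y - y) by apply: val_geB => //; right; lia.
by move/(_ vxn); lia.
Qed.

End Valuation.

Lemma fin_all_exists_double (I J : finType) (T : Type) (P : I -> J -> T -> Prop) :
  (forall i j, exists x, P i j x) ->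
  exists f : I -> J -> T, forall i j, P i j (f i j).
Proof.
move=> exP; apply: (fin_all_exists (P := fun i f => forall j, P i j (f j))) => i.
exact: (fin_all_exists (P := P i)).
Qed.

(** * Residue maps *)

Section Residue.

Variables (K : fieldType) (v : K -> int) (k : fieldType) (r : K -> k).
Hypotheses (hv : discrete_valuation v) (hr : residue_map v r).
Implicit Types x y : K.

Lemma residue0 : r 0 = 0.
Proof.
by apply: (addrI (r 0)); rewrite -(rm_add hr) ?addr0 //; exact: val_ge0.
Qed.

Lemma residueN x : val_ge v 0 x -> r (- x) = - r x.
Proof.
move=> vx; apply: (addrI (r x)).
by rewrite -(rm_add hr) ?subrr ?residue0 //; exact: val_geN.
Qed.

Lemma residue_sum (I : Type) (s : seq I) (F : I -> K) :
  (forall i, val_ge v 0 (F i)) ->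
  r (\sum_(i <- s) F i) = \sum_(i <- s) r (F i).
Proof.
move=> vF; elim: s => [|i s IHs]; first by rewrite !big_nil residue0.
by rewrite !big_cons (rm_add hr) ?IHs //; apply: val_ge_sum.
Qed.

Lemma residueMn x n : val_ge v 0 x -> r (x *+ n) = r x *+ n.
Proof.
move=> vx; elim: n => [|n IHn]; first by rewrite !mulr0n residue0.
rewrite !mulrS (rm_add hr) ?IHn // -mulr_natl.
by apply: val_geM0 => //; exact: val_ge_nat.
Qed.

Lemma residue_nat n : r n%:R = n%:R.
Proof. by rewrite residueMn ?(rm_one hr) //; exact: val_ge1. Qed.

Lemma residue_eqP x y :
  val_ge v 0 x -> val_ge v 0 y -> (r x = r y <-> val_ge v 1 (x - y)).
Proof.
move=> vx vy; have vxy : val_ge v 0 (x - y) by apply: val_geB.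
rewrite -(rm_ker hr vxy) (rm_add hr) ?residueN //; last exact: val_geN.
by split=> [->|/eqP]; [rewrite subrr | rewrite subr_eq0 => /eqP].
Qed.

Lemma residue_eq0 x : val_ge v 1 x -> r x = 0.
Proof. by move=> vx; apply/(rm_ker hr) => //; apply: val_ge_leq vx. Qed.

Lemma residue_neq0 x : x != 0 -> v x = 0 -> r x != 0.
Proof.
move=> nz_x vx; apply/eqP=> /(rm_ker hr) h.
have /h/(val_geE _ _ nz_x) : val_ge v 0 x by right; rewrite vx.
by rewrite vx.
Qed.

End Residue.

(** * The fundamental identity over Q_p *)

Section LocalDegree.

Variables (p : nat) (Q : fieldType) (v : Q -> int).
Hypotheses (p_pr : prime p) (hv : discrete_valuation v).
Hypotheses (v_complete : val_complete v) (p_unif : uniformizer v p%:R).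
Hypothesis v_residue :
  forall x, val_ge v 0 x -> exists n : nat, val_ge v 1 (x - n%:R).
Variables (L : fieldExtType Q) (w : L -> int) (E : nat).
Hypotheses (hw : discrete_valuation w) (E_gt0 : (0 < E)%N).
Hypothesis hE : ramification_index v w E.
Variables (k : fieldType) (r : L -> k) (hr : residue_map w r).
(** Coordinates over F_p on the residue field, so that [g] is the absolute residue degree. *)
Variables (g : nat) (phi : {additive k -> 'rV['F_p]_g}).
Hypothesis phi_bij : bijective phi.

Let hu x n : val_ge v n%:Z x -> val_ge w (E * n)%:Z (x%:A : L).
Proof.
have [->|nz_x] := eqVneq x 0; first by rewrite scale0r; left.
by move/(val_geE _ _ nz_x) => le_n; right; rewrite hE //; nia.
Qed.

Lemma local_val_nat : (p%:R : L) != 0 /\ w p%:R = E%:Z.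
Proof.
have [nz_p vp] := p_unif; have e : (p%:R : L) = p%:R%:A by rewrite scaler_nat.
by rewrite e hE // vp mulr1 scaler_eq0 oner_eq0 orbF.
Qed.

Lemma local_residue_nat : p%:R = 0 :> k.
Proof.
have [_ wp] := local_val_nat.
by rewrite -(residue_nat hw hr); apply: (residue_eq0 hr); right; rewrite wp.
Qed.

Section Expansion.

Variables (varpi : L) (b : 'I_g -> L).
Hypotheses (varpiP : uniformizer w varpi) (b_int : forall i, val_ge w 0 (b i)).
Hypothesis bP : forall i, phi (r (b i)) = delta_mx 0 i.

Let varpi_nz : varpi != 0 := proj1 varpiP.
Let wvarpi : w varpi = 1 := proj2 varpiP.

(** The products [b i * varpi ^+ j] are the candidate basis of [L] over [Q]; bijectivity of this map
    gives the fundamental identity. *)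
Let comb (c : 'M[Q]_(g, E)) : L :=
  \sum_i \sum_j c i j *: (b i * varpi ^+ j).

Let comb_is_linear : linear comb.
Proof.
move=> a c d; rewrite /comb scaler_sumr -big_split /=; apply: eq_bigr => i _.
rewrite scaler_sumr -big_split /=; apply: eq_bigr => j _.
by rewrite !mxE scalerDl scalerA.
Qed.

HB.instance Definition _ :=
  GRing.isLinear.Build Q 'M[Q]_(g, E) L _ comb comb_is_linear.

(** Digits of the [varpi]-adic expansion, chosen as integer combinations of the [b i]. Since
    [varpi ^+ E] and [p] have the same valuation, [E] steps of [nxt] amount to one division by [p],
    and [red z] is the quotient left by that step. *)
Let digit (z : L) : L := \sum_i b i *+ (phi (r z) 0 i : nat).
Let nxt (z : L) : L := (z - digit z) / varpi.
Let red (z : L) : L := varpi ^+ E * iter E nxt z / p%:R.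
Let coef (z : L) : 'M[Q]_(g, E) :=
  \matrix_(i, j) (phi (r (iter j nxt z)) 0 i : nat)%:R.

Let b_intMn i n : val_ge w 0 (b i *+ n).
Proof. by rewrite -mulr_natl; apply: val_geM0 => //; exact: val_ge_nat. Qed.

Let phi_digits (n : 'I_g -> nat) :
  phi (r (\sum_i b i *+ n i)) = \row_i (n i)%:R.
Proof.
rewrite (residue_sum hw hr) // raddf_sum /= [RHS]row_sum_delta.
apply: eq_bigr => i _; rewrite (residueMn hw hr) // raddfMn bP mxE.
by rewrite scaler_nat.
Qed.

Let digit_int z : val_ge w 0 (digit z).
Proof. by apply: val_ge_sum. Qed.

Let digitP z : val_ge w 0 z -> val_ge w 1 (z - digit z).
Proof.
move=> wz; apply/(residue_eqP hw hr) => //; apply: (bij_inj phi_bij).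
by rewrite phi_digits; apply/rowP=> i; rewrite mxE natr_Zp.
Qed.

Let nxt_int z : val_ge w 0 z -> val_ge w 0 (nxt z).
Proof.
move=> wz; apply/(val_ge_mull hw 0 (nxt z) varpi_nz wvarpi); rewrite addr0 /nxt.
by rewrite mulrC divfK //; exact: digitP.
Qed.

Let nxtE z : z = digit z + varpi * nxt z.
Proof. by rewrite /nxt [varpi * _]mulrC divfK // addrC subrK. Qed.

Let iter_nxtE z n :
  z = \sum_(j < n) varpi ^+ j * digit (iter j nxt z) + varpi ^+ n * iter n nxt z.
Proof.
elim: n => [|n IHn]; first by rewrite big_ord0 add0r mul1r.
rewrite big_ord_recr /= -addrA {1}IHn exprSr -mulrA -mulrDr; congr (_ + _ * _).
exact: nxtE.
Qed.

Let iter_nxt_int z n : val_ge w 0 z -> val_ge w 0 (iter n nxt z).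
Proof. by move=> wz; elim: n => //= n; exact: nxt_int. Qed.

Let redE z : z = comb (coef z) + p%:R * red z.
Proof.
have [nz_p _] := local_val_nat.
rewrite {1}[z](iter_nxtE _ E) /red [p%:R * _]mulrC divfK //; congr (_ + _).
rewrite /comb exchange_big /=; apply: eq_bigr => j _.
rewrite mulr_sumr; apply: eq_bigr => i _; rewrite mxE scaler_nat.
by rewrite mulrnAr mulrC.
Qed.

Let red_int z : val_ge w 0 z -> val_ge w 0 (red z).
Proof.
move=> wz; have [nz_p wp] := local_val_nat.
apply/(val_ge_mull hw 0 (red z) nz_p wp); rewrite addr0 /red [p%:R * _]mulrC divfK //.
rewrite -[E%:Z]addr0; apply: val_geM => //; last exact: iter_nxt_int.
exact: unif_val_geX.
Qed.

Let pXZ n (x : L) : p%:R ^+ n *: x = p%:R ^+ n * x.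
Proof. by rewrite -!natrX scaler_nat mulr_natl. Qed.

(** Partial sums of the expansion regrouped by powers of [p], which puts the coefficients in [Q],
    where completeness is available. *)
Let approx z n : 'M[Q]_(g, E) :=
  \sum_(l < n) p%:R ^+ l *: coef (iter l red z).

Let approxE z n : z = comb (approx z n) + p%:R ^+ n * iter n red z.
Proof.
elim: n => [|n IHn].
  by rewrite /approx big_ord0 raddf0 add0r mul1r.
rewrite /approx big_ord_recr /= -/(approx z n) linearD linearZ /= -addrA.
by rewrite pXZ {1}IHn {1}[iter n red z]redE exprSr mulrDr -mulrA.
Qed.

Let val_ge_pX n : val_ge v n%:Z (p%:R ^+ n).
Proof. exact: unif_val_geX. Qed.

Let coef_int z i j : val_ge v 0 (coef z i j).
Proof. by rewrite mxE; exact: val_ge_nat. Qed.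

Let approx_int z n i j : val_ge v 0 (approx z n i j).
Proof.
rewrite /approx summxE; apply: val_ge_sum => // l _; rewrite mxE.
by apply: val_geM0 => //; apply: val_geX => //; exact: val_ge_nat.
Qed.

Let approx_cauchy z m n i j :
  val_ge v m%:Z (approx z (m + n) i j - approx z m i j).
Proof.
rewrite /approx big_split_ord /= [in X in X - _]mxE [X in X - _]addrC addrK summxE.
apply: val_ge_sum => // l _; rewrite mxE exprD -mulrA -[m%:Z]addr0.
apply: val_geM => //; apply: val_geM0 => //.
by apply: val_geX => //; exact: val_ge_nat.
Qed.

Let approx_lim z i j :
  exists2 l : Q, val_ge v 0 l &
    forall n : nat, exists N, forall m, (N <= m)%N ->
      val_ge v n%:Z (approx z m i j - l).
Proof.
have [|l lP] := v_complete (u := fun m => approx z m i j).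
  have cauchy n m1 m2 : (n <= m1)%N -> (m1 <= m2)%N ->
      val_ge v n%:Z (approx z m2 i j - approx z m1 i j).
    move=> le_n le_m; rewrite -(subnKC le_m).
    by apply: val_ge_leq (approx_cauchy _ _ _ _ _); lia.
  move=> n; exists `|n|%N => m1 m2 m1P m2P; apply: (@val_ge_leq _ _ _ `|n|%N); first lia.
  case: (leqP m2 m1) => le_m; first exact: cauchy.
  by apply: val_ge_subC => //; apply: cauchy => //; exact: ltnW.
have lP' (n : nat) := lP n%:Z; exists l => //.
(* The limit is integral because it differs from an integral partial sum by an integral element. *)
have [N /(_ N (leqnn N)) wN] := lP 0.
rewrite -[l](subKr (approx z N i j)); exact: val_geB.
Qed.

(** The coefficients of [approx z n] converge one by one; the combination of their limits differs
    from [z] by an element of arbitrarily large valuation, hence equals it. *)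
Lemma integral_expansion z : val_ge w 0 z ->
  exists2 c : 'M[Q]_(g, E), forall i j, val_ge v 0 (c i j) & z = comb c.
Proof.
move=> wz.
have /fin_all_exists_double[c cP] i j : exists c : Q, val_ge v 0 c /\
    forall n : nat, exists N, forall m, (N <= m)%N ->
      val_ge v n%:Z (approx z m i j - c).
  by have [l] := approx_lim z i j; exists l.
exists (\matrix_(i, j) c i j) => [i j|]; first by rewrite mxE; case: (cP i j).
apply/eqP; rewrite -subr_eq0; apply/eqP/(val_ge_all (v := w)) => n.
have /fin_all_exists_double[N NP] i j : exists N, forall m, (N <= m)%N ->
      val_ge v n%:Z (approx z m i j - c i j).
  by have [_ /(_ n)] := cP i j.
pose m := (n + \max_i \max_j N i j)%N.
have mP i j : (N i j <= m)%N.
  apply: (leq_trans _ (leq_addl n _)).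
  apply: (leq_trans _ (leq_bigmax (F := fun i => \max_j N i j) i)).
  exact: (leq_bigmax (F := N i)).
rewrite {1}[z](approxE z m) addrAC -linearB /=; apply: val_geD => //.
  apply: val_ge_sum => // i _; apply: val_ge_sum => // j _.
  rewrite -mulr_algl -[n%:Z]addr0; apply: val_geM => //; last first.
    by apply: val_geM0 => //; apply: val_geX => //; right; rewrite wvarpi.
  rewrite !mxE; apply: (@val_ge_leq _ _ _ (E * n)%N); first nia.
  exact: hu (NP _ _ _ (mP i j)).
rewrite -[n%:Z]addr0; apply: val_geM => //; last first.
  by elim: m {mP} => //= m; exact: red_int.
apply: (@val_ge_leq _ _ _ m%:Z); first by lia.
have [nz_p wp] := local_val_nat; right; rewrite valX // wp; nia.
Qed.

Let int_Q x : val_ge v 0 x -> val_ge w 0 (x%:A : L).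
Proof. by move=> vx; have := hu (n := 0) vx; rewrite muln0. Qed.

Let residue_Q x : val_ge v 0 x -> exists n : nat,
  r (x%:A : L) = n%:R /\ ((n%:R : 'F_p) = 0 -> val_ge v 1 x).
Proof.
move=> vx; have [n vn] := v_residue vx; exists n; split=> [|n0].
  rewrite -(residue_nat hw hr); apply/(residue_eqP hw hr).
  - exact: int_Q.
  - exact: val_ge_nat.
  rewrite -(scaler_nat n) -scalerBl.
  by apply: val_ge_leq (hu vn); lia.
rewrite -[x](subrK n%:R); apply: val_geD => //.
have /dvdnP[m ->] : (p %| n)%N.
  by rewrite (dvdn_pcharf (pchar_Fp p_pr)) n0.
rewrite mulnC natrM -[1]addr0; apply: val_geM => //.
  by right; rewrite (proj2 p_unif).
exact: val_ge_nat.
Qed.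

(** Strong induction on [j]. In a vanishing combination the terms of index below [j] have
    coefficients divisible by [p], so valuation at least [E > j], and those above carry
    [varpi ^+ j.+1]. Hence [A j] has residue 0, and the residues of the [b i] are independent over
    F_p. *)
Let comb_free1 (c : 'M[Q]_(g, E)) :
  (forall i j, val_ge v 0 (c i j)) -> comb c = 0 ->
  forall i j, val_ge v 1 (c i j).
Proof.
move=> c_int c0 i j.
have [m] := ubnP (j : nat); elim: m => // m IHm in i j * => /ltnSE le_jm.
pose A (l : 'I_E) : L := \sum_i (c i l)%:A * b i.
have combE : comb c = \sum_(j < E) varpi ^+ j * A j.
  rewrite /comb exchange_big /=; apply: eq_bigr => l _.
  by rewrite mulr_sumr; apply: eq_bigr => a _; rewrite mulr_algl -scalerAr [varpi ^+ l * _]mulrC.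
have A_int l : val_ge w 0 (A l).
  apply: val_ge_sum => // a _; apply: val_geM0 => //; exact: int_Q.
have wA : val_ge w 1 (A j).
  apply/(val_ge_mull (m := j) hw 1 _ (expf_neq0 j varpi_nz)).
    by rewrite valX // wvarpi mulr1.
  have -> : varpi ^+ j * A j = - (\sum_(l | l != j) varpi ^+ l * A l).
    by apply/eqP; move/eqP: c0; rewrite combE (bigD1 j) //= addr_eq0.
  apply: val_geN => //; apply: val_ge_sum => // l neq_lj.
  have [lt_lj|lt_jl|/val_inj eq_lj] := ltngtP l j; last by rewrite eq_lj eqxx in neq_lj.
    rewrite mulr_sumr; apply: val_ge_sum => // a _; rewrite mulrCA.
    rewrite -[j%:Z + 1]addr0; apply: val_geM => //; last first.
      by apply: val_geM0 => //; apply: val_geX => //; right; rewrite wvarpi.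
    have vc : val_ge v 1 (c a l) by apply: IHm; exact: leq_trans le_jm.
    by apply: val_ge_leq (hu vc); have := ltn_ord j; lia.
  rewrite -[j%:Z + 1]addr0; apply: val_geM => //.
  by apply: val_ge_leq (unif_val_geX hw l varpiP); lia.
have /fin_all_exists[n nP] a := residue_Q (c_int a j).
apply: (nP i).2; have := congr1 phi (residue_eq0 hr wA).
rewrite raddf0 (residue_sum hw hr); last first.
  by move=> a; apply: val_geM0 => //; exact: int_Q.
have -> : \sum_i r ((c i j)%:A * b i) = r (\sum_i b i *+ n i).
  rewrite (residue_sum hw hr) //; apply: eq_bigr => a _.
  rewrite (rm_mul hr) ?(residueMn hw hr) ?(nP a).1 ?mulr_natl //.
  exact: int_Q.
by rewrite phi_digits => /rowP/(_ i); rewrite !mxE.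
Qed.

(** Descent: a vanishing integral combination is divisible by [p], and its quotient by [p] is
    another one. *)
Let comb_free0 (c : 'M[Q]_(g, E)) (n : nat) :
  (forall i j, val_ge v 0 (c i j)) -> comb c = 0 ->
  forall i j, val_ge v n%:Z (c i j).
Proof.
have [nz_p vp] := p_unif.
elim: n c => // n IHn c c_int c0 i j.
have cE a l : c a l = p%:R * (p%:R^-1 *: c) a l by rewrite mxE mulVKf.
rewrite cE intS; apply/(val_ge_mull hv _ _ nz_p vp); apply: IHn => [a l|].
  have := comb_free1 c_int c0 a l; rewrite cE -[X in val_ge v X]addr0.
  by move/(val_ge_mull hv _ _ nz_p vp).
by rewrite linearZ /= c0 scaler0.
Qed.

Let exists_denom (c : Q) :
  exists n : nat, forall m, (n <= m)%N -> val_ge v 0 (p%:R ^+ m * c).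
Proof.
have [nz_p vp] := p_unif; exists `|v c|%N => m le_m.
have [->|nz_c] := eqVneq c 0; first by rewrite mulr0; left.
by right; rewrite (dv_mul hv) ?expf_neq0 // valX // vp; lia.
Qed.

Let comb_inj : lker (linfun comb) == 0%VS.
Proof.
have [nz_p vp] := p_unif.
rewrite -subv0; apply/subvP=> c; rewrite memv_ker memv0 lfunE /= => /eqP c0.
have /fin_all_exists_double[N NP] i j := exists_denom (c i j).
pose m := \max_i \max_j N i j.
have mP i j : (N i j <= m)%N.
  apply: (leq_trans _ (leq_bigmax (F := fun i => \max_j N i j) i)).
  exact: (leq_bigmax (F := N i)).
have c'0 : comb (p%:R ^+ m *: c) = 0 by rewrite linearZ /= c0 scaler0.
apply/eqP/matrixP=> i j; apply: (mulfI (expf_neq0 m nz_p)).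
rewrite [X in _ = _ * X]mxE mulr0; apply: (val_ge_all (v := v)) => n.
have -> : p%:R ^+ m * c i j = (p%:R ^+ m *: c) i j by rewrite mxE.
by apply: comb_free0 => // a l; rewrite mxE; exact: NP (mP a l).
Qed.

(** A power of [p] makes any element integral, and integral elements have expansions. *)
Let comb_surj : limg (linfun comb) = fullv.
Proof.
have [nz_p wp] := local_val_nat; have [nz_p' _] := p_unif.
apply/vspaceP=> z; rewrite memvf.
have [m wz] : exists m, val_ge w 0 (p%:R ^+ m * z).
  exists `|w z|%N; have [->|nz_z] := eqVneq z 0; first by rewrite mulr0; left.
  by right; rewrite (dv_mul hw) ?expf_neq0 // valX // wp; nia.
have [c _ zE] := integral_expansion wz.
suff -> : z = linfun comb (p%:R ^- m *: c) by apply: memv_img; rewrite memvf.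
by rewrite lfunE /= linearZ /= -zE -pXZ scalerA mulVf ?scale1r ?expf_neq0.
Qed.

Lemma dim_expansion : \dim {:L} = (E * g)%N.
Proof.
rewrite -comb_surj limg_dim_eq; last by rewrite (eqP comb_inj) capv0.
by rewrite dimvf /dim /= mulnC.
Qed.

End Expansion.

Lemma exists_expansion_basis : exists (varpi : L) (b : 'I_g -> L),
  [/\ uniformizer w varpi, forall i, val_ge w 0 (b i) &
      forall i, phi (r (b i)) = delta_mx 0 i].
Proof.
have [varpi varpiP] := dv_unif hw; have [psi _ phiK] := phi_bij; exists varpi.
have /fin_all_exists[b bP] (i : 'I_g) : exists x : L,
    val_ge w 0 x /\ r x = psi (delta_mx 0 i).
  by have [x wx xP] := rm_surj hr (psi (delta_mx 0 i)); exists x.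
by exists b; split=> // i; case: (bP i) => // _ bi; rewrite bi phiK.
Qed.

Lemma local_degree : \dim {:L} = (E * g)%N.
Proof.
have [varpi [b [varpiP b_int bP]]] := exists_expansion_basis.
exact: dim_expansion varpiP b_int bP.
Qed.

(* The expansion bounds [w (h z)] below uniformly over integral [z]; applied to
   all the powers of [z] this gives [w (h z) >= 0]. *)
Lemma morph_integral (h : {rmorphism L -> L}) z :
  (forall (c : Q) x, h (c *: x) = c *: h x) -> val_ge w 0 z -> val_ge w 0 (h z).
Proof.
move=> hZ wz; have [varpi [b [varpiP b_int bP]]] := exists_expansion_basis.
have [nz_p wp] := local_val_nat.
pose C := (\sum_i \sum_(j < E) `|w (h (b i * varpi ^+ j)%R)|)%N.
have leC i (j : 'I_E) : (`|w (h (b i * varpi ^+ j)%R)| <= C)%N.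
  by rewrite /C (bigD1 i) //= (bigD1 j) //=; lia.
have [hz0|nz_hz] := eqVneq (h z) 0; first by rewrite hz0; left.
have bound n : - C%:Z <= n%:Z * w (h z).
  rewrite -valX // -rmorphXn /=; apply/val_geE; first by rewrite rmorphXn expf_neq0.
  have [c c_int ->] := integral_expansion varpiP b_int bP (val_geX hw n wz).
  rewrite (rmorph_sum h); apply: val_ge_sum => // i _.
  rewrite (rmorph_sum h); apply: val_ge_sum => // j _ /=.
  rewrite hZ -mulr_algl -[- C%:Z]add0r; apply: val_geM => //.
    by have := hu (n := 0) (c_int i j); rewrite muln0.
  by have := leC i j; right; lia.
by right; have := bound C.+1; nia.
Qed.

End LocalDegree.

(** * The residue field of Q_p *)

Lemma padic_uniformizer (p : nat) (Qp : fieldType) (v : Qp -> int) :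
  prime p -> is_padic_completion p v -> uniformizer v p%:R.
Proof.
move=> p_pr hQp; have [iota [vE _]] := pc_dense hQp.
have nz_p : (p%:R : rat) != 0 by rewrite pnatr_eq0 -lt0n prime_gt0.
have numE : numq p%:R = p%:Z by rewrite -[p%:R]/(p%:Z%:~R) numq_int.
have denE : denq p%:R = 1 by rewrite -[p%:R]/(p%:Z%:~R) denq_int.
rewrite -(rmorph_nat iota); split; first by rewrite fmorph_eq0.
by rewrite vE // /padic_val numE denE /= logn1 logn_prime // eqxx.
Qed.

(** Density replaces [x] by a rational [a / d] of nonnegative valuation. Then [d] is prime to [p],
    and [a] times an inverse of [d] modulo [p] represents the residue. *)
Lemma padic_residue (p : nat) (Qp : fieldType) (v : Qp -> int) x :
  prime p -> is_padic_completion p v -> val_ge v 0 x ->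
  exists n : nat, val_ge v 1 (x - n%:R).
Proof.
move=> p_pr hQp vx; have [iota [vE dense]] := pc_dense hQp.
have hv := pc_val hQp; have p_unif := padic_uniformizer p_pr hQp.
have [s vxs] := dense x 1.
have vs : val_ge v 0 (iota s).
  rewrite -[iota s](subKr x); apply: val_geB => //.
  exact: val_ge_leq vxs.
have p_dvd (m : int) : (p%:Z %| m)%Z -> val_ge v 1 (iota m%:~R).
  case/dvdzP=> c ->; rewrite intrM rmorphM mulrC -[1]addr0.
  apply: val_geM => //; first by rewrite rmorph_int; right; rewrite (proj2 p_unif).
  rewrite rmorph_int; case: c => c; first exact: val_ge_nat.
  by rewrite NegzE rmorphN; apply: val_geN => //; exact: val_ge_nat.
set a := numq s; set d := denq s.
have nz_d : iota d%:~R != 0 by rewrite fmorph_eq0 intr_eq0 denq_eq0.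
have sE : iota s * iota d%:~R = iota a%:~R.
  by rewrite -rmorphM /= -numqE.
(* If [p] divided the denominator, it would not divide the numerator, and the valuation would be
   negative. *)
have cop_d : coprime `|d| p.
  rewrite coprime_sym prime_coprime //; apply/negP=> p_d.
  have cop_ad : coprime `|a| `|d| := coprime_num_den s.
  have p_a : ~~ (p %| `|a|)%N.
    apply/negP=> p_a; have : (p %| 1)%N by rewrite -(eqP cop_ad) dvdn_gcd p_a.
    by rewrite dvdn1 => /eqP p1; rewrite p1 in p_pr.
  have nz_s : s != 0 by apply/eqP=> s0; rewrite /a s0 dvdn0 in p_a.
  have nz_is : iota s != 0 by rewrite fmorph_eq0.
  have /(val_geE _ _ nz_is) := vs; rewrite vE // /padic_val -/a -/d.
  have -> : logn p `|a| = 0%N by rewrite lognE (negbTE p_a) !andbF.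
  have : (0 < logn p `|d|)%N by rewrite logn_gt0 mem_primes p_pr absz_gt0 denq_eq0.
  lia.
have vd : v (iota d%:~R) = 0.
  have nz_dq : (d%:~R : rat) != 0 by rewrite intr_eq0 denq_eq0.
  rewrite vE // /padic_val numq_int denq_int /= logn1 lognE.
  by move: cop_d; rewrite coprime_sym prime_coprime // => /negbTE ->; rewrite !andbF.
have [u [c uc]] : exists u c : int, d * u = 1 + p%:Z * c.
  have /coprimezP[[u c] /= uc] : coprimez d p%:Z by [].
  by exists u, (- c); rewrite mulrN mulrC [p%:Z * c]mulrC -uc addrK.
exists `|(a * u %% p)%Z|%N.
rewrite -[x](subrK (iota s)) -addrA; apply: val_geD => //.
rewrite -(rmorph_nat iota); set n := `|_|%N.
have nE : n%:Z = a * u - (a * u %/ p)%Z * p.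
  rewrite {1}(divz_eq (a * u) p) addrC addKr /n gez0_abs // modz_ge0 //.
  by have := prime_gt0 p_pr; lia.
suff : val_ge v 1 (iota d%:~R * (iota s - iota n%:R)).
  by rewrite -[1]add0r => /(val_ge_mull hv 1 _ nz_d vd); rewrite add0r.
have -> : iota d%:~R * (iota s - iota n%:R) = iota (a - d * n%:Z)%:~R.
  by rewrite mulrBr mulrC sE -rmorphM -rmorphB /= intrB intrM.
apply: p_dvd; apply/dvdzP; exists (d * (a * u %/ p)%Z - a * c).
rewrite nE mulrBr mulrCA uc; ring.
Qed.

Lemma finField_additive_basis (p : nat) (k : finFieldType) :
  prime p -> p%:R = 0 :> k ->
  exists (n : nat) (phi : {additive k -> 'rV['F_p]_n}),
    bijective phi /\ #|k| = (p ^ n)%N.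
Proof.
move=> p_pr p0; have charkp : p \in [pchar k] by rewrite inE p_pr p0 eqxx.
pose R : vectType 'F_p := pPrimeCharType charkp.
pose n : nat := \dim {:R}; pose e := vbasis {:R}.
pose phi0 (x : k) : 'rV['F_p]_n := \row_i coord e i (x : R).
have phi0B : zmod_morphism phi0.
  move=> x y; apply/rowP=> i; rewrite !mxE.
  exact: (linearB (coord e i) (x : R) (y : R)).
pose phi : {additive k -> 'rV['F_p]_n} :=
  HB.pack phi0 (GRing.isZmodMorphism.Build _ _ phi0 phi0B).
have phi_bij : bijective phi.
  exists (fun u : 'rV['F_p]_n => \sum_(i < n) u 0 i *: e`_i : R) => [x|u].
    rewrite [RHS](coord_vbasis (memvf (x : R))).
    by apply: eq_bigr => i _; rewrite mxE.
  apply/rowP=> i; rewrite mxE coord_sum_free //.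
  exact: basis_free (vbasisP _).
exists n, phi; split=> //; rewrite (bij_eq_card phi_bij).
by rewrite card_mx mul1n card_Fp.
Qed.

(** * Tame Galois groups *)

Section LocalGalois.

Variables (K : fieldType) (F : splittingFieldType K) (w : F -> int).
Variables (k : fieldType) (r : F -> k).
Hypotheses (hw : discrete_valuation w) (hr : residue_map w r).
Hypothesis gal_integral :
  forall (g : gal_of {:F}) x, val_ge w 0 x -> val_ge w 0 (g x).
Variables (pi : F) (e : nat) (piK : K).
Hypotheses (e_gt0 : (0 < e)%N) (pi_unif : uniformizer w pi).
Hypothesis pi_root : pi ^+ e = piK%:A.
Implicit Types (g : gal_of {:F}) (x y u : F).

Lemma galMf g h x : (g * h)%g x = h (g x).
Proof. by rewrite galM ?memvf. Qed.

Lemma galVK g x : (g^-1)%g (g x) = x.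
Proof. by rewrite -galMf mulgV gal_id. Qed.

Let pi_nz : pi != 0 := proj1 pi_unif.
Let w_pi : w pi = 1 := proj2 pi_unif.

Let gal_nz g x : x != 0 -> g x != 0.
Proof. by rewrite fmorph_eq0. Qed.

Let gal_val0 g x : x != 0 -> w x = 0 -> w (g x) = 0.
Proof.
move=> nz_x /(val_unitP hw nz_x)[wx wx'].
apply/(val_unitP hw (gal_nz g nz_x)); split; first exact: gal_integral.
by rewrite -fmorphV; exact: gal_integral.
Qed.

Let gal_fixK g a : g a%:A = a%:A.
Proof. by rewrite linearZ /= rmorph1. Qed.

Let gal_val_pi g : w (g pi) = 1.
Proof.
have wpi : w (g (pi ^+ e)) = w (pi ^+ e) by rewrite pi_root gal_fixK.
have nz_e : e%:Z != 0 by lia.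
by apply: (mulfI nz_e); move: wpi; rewrite rmorphXn !(valX hw) ?gal_nz // w_pi.
Qed.

Let unif_decomp x : x != 0 -> 0 <= w x ->
  exists u n, [/\ u != 0, w u = 0 & x = u * pi ^+ n].
Proof.
move=> nz_x wx; exists (x / pi ^+ `|w x|%N), `|w x|%N.
have nz_pin : pi ^+ `|w x|%N != 0 by rewrite expf_neq0.
split; last by rewrite divfK.
  by rewrite mulf_neq0 ?invr_eq0.
by rewrite (dv_mul hw) ?invr_eq0 // valV // valX // w_pi; lia.
Qed.

(** Every integral element is a unit times a power of [pi]. Units stay units since [g] preserves
    integrality, and [w (g pi) = 1] because [pi ^+ e] lies in [K] and is fixed. *)
Lemma gal_val g x : x != 0 -> w (g x) = w x.
Proof.
have wlog_ge0 y : y != 0 -> 0 <= w y -> w (g y) = w y.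
  move=> nz_y wy; have [u [n [nz_u wu ->]]] := unif_decomp nz_y wy.
  have nz_n : pi ^+ n != 0 by rewrite expf_neq0.
  rewrite rmorphM rmorphXn /= !(dv_mul hw) ?gal_nz ?expf_neq0 ?gal_nz //.
  by rewrite gal_val0 // wu !valX ?gal_nz // gal_val_pi w_pi.
move=> nz_x; have [wx|wx] := lerP 0 (w x); first exact: wlog_ge0.
have nz_x' : x^-1 != 0 by rewrite invr_eq0.
have := wlog_ge0 _ nz_x'; rewrite fmorphV /= !valV ?gal_nz //.
by move=> /(_ _)/oppr_inj; apply; lia.
Qed.

(** At [x = pi], for [g] in the inertia group, this is the tame character. *)
Let ratio g x := r (g x / x).

Let ratio_int g x : val_ge w 0 (g x / x).
Proof.
have [->|nz_x] := eqVneq x 0; first by rewrite invr0 mulr0; left.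
right; rewrite (dv_mul hw) ?gal_nz ?invr_eq0 // valV // gal_val //.
by rewrite subrr.
Qed.

Let ratioM g x y : ratio g (x * y) = ratio g x * ratio g y.
Proof. by rewrite /ratio -(rm_mul hr) // rmorphM invfM mulrACA. Qed.

Let ratioX g x n : x != 0 -> ratio g (x ^+ n) = ratio g x ^+ n.
Proof.
move=> nz_x; elim: n => [|n IHn]; last by rewrite !exprS ratioM IHn.
by rewrite /ratio rmorph1 divr1 (rm_one hr).
Qed.

Let ratio_unit g u : u != 0 -> w u = 0 -> r (g u) = r u -> ratio g u = 1.
Proof.
move=> nz_u wu ru.
have nz_ru : r u != 0 := residue_neq0 hr nz_u wu.
apply: (mulIf nz_ru); rewrite mul1r -(rm_mul hr) //; last by right; rewrite wu.
by rewrite divfK.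
Qed.

Section Inertia.

Variable g : gal_of {:F}.
Hypothesis g_inert : forall x, val_ge w 0 x -> r (g x) = r x.

(** The ratio is multiplicative in [x] and trivial on units for inertial [g], so its value at [pi]
    decides. *)
Let ratio1 x : r (g pi / pi) = 1 -> x != 0 -> ratio g x = 1.
Proof.
rewrite -/(ratio g pi) => rho_pi.
have wlog_ge0 y : y != 0 -> 0 <= w y -> ratio g y = 1.
  move=> nz_y wy; have [u [n [nz_u wu ->]]] := unif_decomp nz_y wy.
  rewrite ratioM ratioX // rho_pi expr1n mulr1 ratio_unit // g_inert //.
  by right; rewrite wu.
move=> nz_x; have [wx|wx] := lerP 0 (w x); first exact: wlog_ge0.
have nz_x' : x^-1 != 0 by rewrite invr_eq0.
have := ratioM g x x^-1; rewrite (wlog_ge0 _ nz_x') ?valV //; last lia.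
by rewrite mulr1 => <-; rewrite mulfV // /ratio rmorph1 divr1 (rm_one hr).
Qed.

(* The wild inertia argument: [g] moves every [x] by an element of larger
   valuation, so for [y = g x - x] the relation [\sum_(j < e) g^j y = 0] has
   leading term [e y]. *)
Lemma tame_inertia_faithful :
  (e%:R : k) != 0 -> (g ^+ e = 1)%g -> r (g pi / pi) = 1 -> g = 1%g.
Proof.
move=> nz_e g_e rho_pi.
have move_up x : x != 0 -> val_ge w (w x + 1) (g x - x).
  move=> nz_x; have up : val_ge w 1 (g x / x - 1).
    apply/(residue_eqP hw hr); [exact: ratio_int | exact: val_ge1 |].
    by rewrite (rm_one hr); exact: ratio1.
  have -> : g x - x = x * (g x / x - 1) by rewrite mulrBr mulr1 mulrC divfK.
  by apply: val_geM => //; right.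
apply/eqP/gal_eqP=> x _; rewrite gal_id; apply/eqP; rewrite -subr_eq0.
apply/negPn/negP=> nz_y; set y := g x - x in nz_y.
have up_y j : val_ge w (w y + 1) ((g ^+ j)%g y - y).
  elim: j => [|j IHj]; first by rewrite gal_id subrr; left.
  rewrite expgSr galMf -[_ - y](subrKA (g y)) -rmorphB /=.
  apply: val_geD => //; last exact: move_up.
  have [->|nz_z] := eqVneq ((g ^+ j)%g y - y) 0; first by rewrite rmorph0; left.
  by right; rewrite gal_val //; apply/(val_geE _ _ nz_z).
have sum_y : \sum_(j < e) (g ^+ j)%g y = 0.
  rewrite (eq_bigr (fun j : 'I_e => (g ^+ j.+1)%g x - (g ^+ j)%g x)); last first.
    by move=> j _; rewrite /y rmorphB /= expgS galMf.
  rewrite -(big_mkord xpredT (fun j => (g ^+ j.+1)%g x - (g ^+ j)%g x)).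
  by rewrite telescope_sumr // g_e expg0 subrr.
have nz_eF : (e%:R : F) != 0.
  by apply: contraNneq nz_e => e0; rewrite -(residue_nat hw hr) e0 (residue0 hr).
have w_e : w e%:R = 0.
  have /(val_geE _ _ nz_eF) : val_ge w 0 e%:R by exact: val_ge_nat.
  rewrite le_eqVlt => /predU1P[<- //|w_e]; case/eqP: nz_e.
  by rewrite -(residue_nat hw hr); apply: (residue_eq0 hr); right; rewrite -gtz0_ge1.
have [] := val_add_eq (x := e%:R * y) (n := w y)
  (y := \sum_(j < e) ((g ^+ j)%g y - y)) hw.
- by rewrite mulf_neq0.
- by rewrite (dv_mul hw) // w_e add0r.
- by apply: val_ge_sum => // j _.
rewrite sumrB sum_y sumr_const card_ord mulr_natl sub0r subrr.
by rewrite eqxx.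
Qed.

(** In general [g pi / pi] is a cocycle in [g]; inertia acts trivially on residues, so its reduction
    is multiplicative. *)
Lemma inertia_ratioX n : r ((g ^+ n)%g pi / pi) = r (g pi / pi) ^+ n.
Proof.
elim: n => [|n IHn]; first by rewrite gal_id mulfV // (rm_one hr).
rewrite expgSr galMf exprSr -IHn -(g_inert (ratio_int (g ^+ n)%g pi)).
rewrite -(rm_mul hr) //; last exact: gal_integral (ratio_int _ _).
by rewrite rmorphM fmorphV /= mulrA divfK // gal_nz.
Qed.

End Inertia.

Lemma gal_ratio_unity g : r (g pi / pi) ^+ e = 1.
Proof.
rewrite -/(ratio g pi) -ratioX // /ratio pi_root gal_fixK mulfV ?(rm_one hr) //.
by rewrite -pi_root expf_neq0.
Qed.

Lemma frobenius_iter q g x n : lifts_frobenius w r q g -> val_ge w 0 x ->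
  r ((g ^+ n)%g x) = r x ^+ (q ^ n).
Proof.
move=> hg wx; elim: n => [|n IHn]; first by rewrite gal_id expn0 expr1.
rewrite expgSr galMf hg; last exact: gal_integral.
by rewrite IHn -exprM expnSr.
Qed.

End LocalGalois.

(** * Valuations of roots of unity *)

Lemma val_unity_root (K : fieldType) (v : K -> int) (n : nat) (z : K) :
  discrete_valuation v -> (0 < n)%N -> z ^+ n = 1 -> v z = 0.
Proof.
move=> hv n_gt0 zn; have nz_z : z != 0.
  by apply: contra_eq_neq zn => ->; rewrite expr0n gtn_eqF // eq_sym oner_eq0.
have : v (z ^+ n) = 0 by rewrite zn val_one.
by rewrite valX // => /eqP; rewrite mulf_eq0 => /orP[|/eqP //]; lia.
Qed.

(* [p = \prod_(0 < i < p) (1 - z^i)] and the factors are associate. *)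
Lemma val_prime_cyclotomic (K : fieldType) (v : K -> int) (p : nat) (z : K) :
  discrete_valuation v -> prime p -> p.-primitive_root z ->
  exists m : nat, v p%:R = (p.-1 * m)%N%:Z.
Proof.
move=> hv p_pr z_prim; have p_gt0 := prime_gt0 p_pr.
have z_p := prim_expr_order z_prim.
have z_int i : val_ge v 0 (z ^+ i).
  apply: val_geX => //; right.
  by rewrite (val_unity_root hv p_gt0 z_p).
have nz1 i : ~~ (p %| i)%N -> 1 - z ^+ i != 0.
  by rewrite (prim_order_dvd z_prim) subr_eq0 eq_sym.
have ndvd i : (0 < i < p)%N -> ~~ (p %| i)%N.
  by case/andP=> i_gt0 lt_ip; apply/negP=> /(dvdn_leq i_gt0); rewrite leqNgt lt_ip.
have val_le i j : ~~ (p %| j)%N -> val_ge v (v (1 - z ^+ j)) (1 - z ^+ (j * i)).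
  move=> p'j; rewrite exprM -[1 - (_ ^+ i)]opprB subrX1 -mulNr opprB -[v _]addr0.
  apply: val_geM => //; first by right.
  by apply: val_ge_sum => // l _; rewrite -exprM.
have val_eq i : (0 < i < p)%N -> v (1 - z ^+ i) = v (1 - z).
  move=> ip; have p'i := ndvd _ ip.
  have p'1 : ~~ (p %| 1)%N by rewrite dvdn1 neq_ltn prime_gt1 ?orbT.
  apply: le_anti; apply/andP; split; last first.
    by apply/(val_geE _ _ (nz1 _ p'i)); have := val_le i 1%N p'1; rewrite mul1n.
  have [j ij] : exists j, i * j = 1 %[mod p].
    have cop : coprime i p by rewrite coprime_sym prime_coprime.
    have [i_gt0 _] := andP ip.
    case: (egcdnP p i_gt0) => u l ul _; exists u.
    by rewrite mulnC ul addnC (eqP cop) -modnDmr modnMl addn0.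
  have zij : z ^+ (i * j) = z.
    by rewrite -(prim_expr_mod z_prim) ij (prim_expr_mod z_prim) expr1.
  have := val_le j i p'i; rewrite zij => /(val_geE _ _ _); apply.
  by rewrite -[z]expr1 nz1.
have pE : (p%:R : K) = \prod_(1 <= i < p) (1 - z ^+ i).
  have nzX : ('X - 1 : {poly K}) != 0 by rewrite polyXsubC_eq0.
  have polyE : \prod_(1 <= i < p) ('X - (z ^+ i)%:P) = \sum_(i < p) 'X^i.
    apply: (mulfI nzX); rewrite -subrX1 -(factor_Xn_sub_1 z_prim).
    by rewrite [in RHS]big_ltn // expr0.
  have := congr1 (horner^~ 1) polyE; rewrite horner_prod horner_sum.
  rewrite (eq_bigr (fun i => 1 - z ^+ i)) => [->|i _]; last by rewrite hornerXsubC.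
  rewrite (eq_bigr (fun=> 1)) => [|i _]; last by rewrite hornerXn expr1n.
  by rewrite sumr_const card_ord.
have [m mP] : exists m : nat, v (1 - z) = m%:Z.
  have p'1 : ~~ (p %| 1)%N by rewrite dvdn1 neq_ltn prime_gt1 ?orbT.
  have /(val_geE _ _ (nz1 _ p'1)) : val_ge v 0 (1 - z ^+ 1).
    by apply: val_geB => //; exact: val_ge1.
  by rewrite expr1; case: (v _) => // m _; exists m.
exists m; rewrite pE.
have -> : p.-1 = (\sum_(1 <= i < p) 1)%N by rewrite sum_nat_const_nat muln1 subn1.
rewrite big_nat [in RHS]big_nat.
suff [] : \prod_(1 <= i < p | (0 < i < p)%N) (1 - z ^+ i) != 0 /\
  v (\prod_(1 <= i < p | (0 < i < p)%N) (1 - z ^+ i)) =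
  ((\sum_(1 <= i < p | (0 < i < p)%N) 1) * m)%N%:Z by [].
elim/big_rec2: _ => [|i a b ip [nz_b vb]]; first by rewrite oner_neq0 val_one.
rewrite mulf_neq0 ?nz1 ?ndvd // (dv_mul hv) ?nz1 ?ndvd //.
by rewrite vb val_eq // mP; split=> //; lia.
Qed.

Lemma card_finvect (k0 : finFieldType) (k : fieldExtType k0) :
  #|(finvect_type k : finFieldType)| = (#|k0| ^ \dim {:k})%N.
Proof.
have := card_vspacef (Vector.class (finvect_type k : vectType k0)).
by rewrite card_vspace => ->.
Qed.

Lemma card_fieldExt_additive (p d : nat) (k0 : finFieldType) (k : fieldExtType k0)
    (phi : {additive k -> 'rV['F_p]_d}) :
  prime p -> bijective phi -> (p ^ d = #|k0| ^ \dim {:k})%N.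
Proof.
move=> p_pr phi_bij.
have phi_bij' : bijective (phi : (finvect_type k : finFieldType) -> _) by [].
by rewrite -card_finvect (bij_eq_card phi_bij') card_mx mul1n card_Fp.
Qed.

Lemma fieldExt_expf_card (k0 : finFieldType) (k : fieldExtType k0) (x : k) :
  x ^+ (#|k0| ^ \dim {:k}) = x.
Proof.
by rewrite -card_finvect; exact: (@expf_card (finvect_type k : finFieldType)).
Qed.

(** All elements are roots of ['X^n - 'X], which has at most [n] of them. *)
Lemma fieldExt_expf_ge (k0 : finFieldType) (k : fieldExtType k0) (n : nat) :
  (1 < n)%N -> (forall x : k, x ^+ n = x) -> (#|k0| ^ \dim {:k} <= n)%N.
Proof.
move=> n_gt1 xn; rewrite -card_finvect; set k' : finFieldType := finvect_type k.
have sz : size ('X^n - 'X : {poly k'}) = n.+1.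
  by rewrite size_polyDl ?size_polyXn // size_polyN size_polyX.
have nz : ('X^n - 'X : {poly k'}) != 0 by rewrite -size_poly_eq0 sz.
rewrite -ltnS -sz cardE; apply: max_poly_roots => //; last exact: enum_uniq.
by apply/allP=> x _; rewrite rootE !hornerE (xn x) subrr.
Qed.

(** * The Galois group of a split tame extension *)

Section Structure.

Variables (p : nat) (p_pr : prime p).
Variables (Qp : fieldType) (vp : Qp -> int) (hQp : is_padic_completion p vp).
Variables (K : fieldExtType Qp) (vK : K -> int) (hvK : discrete_valuation vK).
Variables (eK : nat) (eK_gt0 : (0 < eK)%N) (heK : ramification_index vp vK eK).
Variables (F : splittingFieldType K) (vF : F -> int).
Variables (hvF : discrete_valuation vF).
Variables (e : nat) (e_gt0 : (0 < e)%N) (he : ramification_index vK vF e).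

Let p_unif := padic_uniformizer p_pr hQp.

(** [baseFieldType F] is [F] regarded as an extension of [Qp], to which the fundamental identity
    applies. *)
Let ramF : ramification_index vp (vF : baseFieldType F -> int) (eK * e).
Proof.
move=> x nz_x; have -> : (x%:A : baseFieldType F) = (x%:A)%:A by [].
by rewrite he ?heK ?scaler_eq0 ?oner_eq0 ?orbF // mulrA mulrC; lia.
Qed.

Lemma ramification_mul (eF : nat) : vF p%:R = eF%:Z -> eF = (e * eK)%N.
Proof.
by have [_ /= ->] := local_val_nat p_unif ramF; rewrite mulnC => -[].
Qed.

Let eKe_gt0 : (0 < eK * e)%N. Proof. by rewrite muln_gt0 eK_gt0. Qed.

Lemma residueF_nat (k : fieldType) (r : F -> k) :
  residue_map vF r -> p%:R = 0 :> k.
Proof.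
exact: (local_residue_nat p_unif
  (hvF : discrete_valuation (vF : baseFieldType F -> int)) eKe_gt0 ramF).
Qed.

Variables (kK : finFieldType) (rK : K -> kK) (hrK : residue_map vK rK).
Variables (kF : fieldExtType kK) (rF : F -> kF) (hrF : residue_map vF rF).
Variables (q f : nat) (hq : q = #|kK|) (hf : f = \dim {:kF}).
Variables (d : nat) (phi : {additive kF -> 'rV['F_p]_d}) (phi_bij : bijective phi).

Lemma residue_degree_exists : exists fK : nat,
  [/\ q = (p ^ fK)%N, d = (fK * f)%N & \dim {:K} = (eK * fK)%N].
Proof.
have p0 : p%:R = 0 :> kK by apply: (local_residue_nat p_unif hvK eK_gt0 heK hrK).
have [fK [psi [psi_bij cardk]]] := finField_additive_basis p_pr p0.
exists fK; split; first by rewrite hq.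
  have := card_fieldExt_additive p_pr phi_bij; rewrite cardk -hf -expnM.
  by move/eqP; rewrite eqn_exp2l ?prime_gt1 // => /eqP.
apply: (local_degree p_pr (pc_val hQp) (pc_complete hQp) p_unif _ hvK eK_gt0 heK hrK psi_bij).
by move=> x; exact: (padic_residue p_pr hQp).
Qed.

Let padic_res x : val_ge vp 0 x -> exists n : nat, val_ge vp 1 (x - n%:R).
Proof. exact: (padic_residue p_pr hQp). Qed.

(** The fundamental identity computes both [F : Q_p] and [K : Q_p]; their quotient is the order of
    the group, the extension being separable in characteristic 0. *)
Lemma galois_degree : #|'Gal({:F} / 1)%g| = (e * f)%N.
Proof.
have [fK [qE dE dimK]] := residue_degree_exists.
have := local_degree p_pr (pc_val hQp) (pc_complete hQp) p_unif padic_res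
  (hvF : discrete_valuation (vF : baseFieldType F -> int)) eKe_gt0 ramF hrF phi_bij.
have -> : \dim {:baseFieldType F} = (\dim {:F} * \dim {:K})%N.
  rewrite -dim_baseVspace; congr (\dim _); apply/vspaceP=> x.
  by rewrite mem_baseVspace memvf; apply/esym; exact: memvf.
rewrite dimK dE; have galF : galois 1 {:F}.
  rewrite /galois sub1v normalFieldf andbT /=; apply/separableP=> x _.
  apply: pcharf0_separable => l; rewrite inE /=; apply/negbTE/negP=> /andP[l_pr].
  have [iota _] := pc_dense hQp.
  have -> : (l%:R : F) = ((iota l%:R)%:A : K)%:A.
    by rewrite rmorph_nat !scaler_nat.
  rewrite !scaler_eq0 !oner_eq0 !orbF fmorph_eq0 pnatr_eq0.
  by move/eqP=> l0; rewrite l0 in l_pr.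
rewrite -(galois_dim galF) dimv1 divn1 => dimF.
have fK_gt0 : (0 < fK)%N.
  case: fK qE {dE dimK dimF} => // qE; have := finNzRing_gt1 kK.
  by rewrite -hq qE.
have eKfK_gt0 : (0 < eK * fK)%N by rewrite muln_gt0 eK_gt0.
by apply/eqP; rewrite -(eqn_pmul2r eKfK_gt0) dimF; apply/eqP; ring.
Qed.

Lemma galF_integral (g : gal_of {:F}) x : val_ge vF 0 x -> val_ge vF 0 (g x).
Proof.
apply: (morph_integral p_pr (pc_val hQp) (pc_complete hQp) p_unif
  (hvF : discrete_valuation (vF : baseFieldType F -> int)) eKe_gt0 ramF hrF
  phi_bij (h := (g : {rmorphism F -> F}))).
move=> c y; exact: (linearZ_LR (g : 'End(F))).
Qed.

Variables (tame : coprime e p) (tau ups : gal_of {:F}).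
Hypotheses (hT : is_inertia vF rF <[tau]>%g) (hU : lifts_frobenius vF rF q ups).
Hypothesis split : (<[tau]> ><| <[ups]>)%g = 'Gal({:F} / 1)%g.
Variables (pi : F) (pi_fix : pi \in fixedField <[ups]>%g).
Hypothesis pi_unif : uniformizer vF pi.
Variables (piK : K) (pi_root : pi ^+ e = piK%:A).
Variables (zetabar : kF) (hzetabar : zetabar = rF (tau pi / pi)).

Let frob_iter := @frobenius_iter _ _ _ _ rF galF_integral.

(** The element [ups ^+ f] acts trivially on residues, so it lies in the inertia group, which meets
    [<[ups]>] trivially. Conversely, with [n] the order of [ups], every residue satisfies
    [y ^+ (q ^ n) = y], whence [q ^ f <= q ^ n]. *)
Lemma order_frobenius : #[ups]%g = f.
Proof.
have f_gt0 : (0 < f)%N by rewrite hf adim_gt0.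
have q_gt1 : (1 < q)%N by rewrite hq finNzRing_gt1.
have [_ _ _ tiTU] := sdprodP split.
apply/eqP; rewrite eqn_leq; apply/andP; split.
  apply: dvdn_leq => //; rewrite order_dvdn; apply/eqP/set1gP; rewrite -tiTU.
  rewrite inE mem_cycle andbT; apply/hT => x wx.
  by rewrite (frob_iter f hU wx) hq hf fieldExt_expf_card.
rewrite -(leq_exp2l _ _ q_gt1) {1}hq {1}hf; apply: fieldExt_expf_ge.
  by rewrite -{1}(expn0 q) ltn_exp2l // order_gt0.
move=> y; have [x wx <-] := rm_surj hrF y.
by rewrite -(frob_iter #[ups]%g hU wx) expg_order gal_id.
Qed.

Lemma order_inertia : #[tau]%g = e.
Proof.
have f_gt0 : (0 < f)%N by rewrite hf adim_gt0.
have := sdprod_card split; rewrite galois_degree.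
rewrite -![#|<[_]>%g|]/(#[_]%g) order_frobenius => /eqP.
by rewrite eqn_pmul2r // => /eqP.
Qed.

(** If [m] is the order of [zetabar], then [tau ^+ m] is killed by the tame character, which is
    faithful on inertia; so the order [e] of [tau] divides [m]. *)
Lemma tame_ratio_primitive : e.-primitive_root zetabar.
Proof.
have z_e : zetabar ^+ e = 1.
  by rewrite hzetabar (gal_ratio_unity hvF hrF galF_integral e_gt0 pi_unif pi_root).
have [m m_prim m_e] := prim_order_exists e_gt0 z_e.
suff <- : m = e by [].
apply/eqP; rewrite eqn_dvd m_e -order_inertia order_dvdn; apply/eqP.
have tau_inert x : val_ge vF 0 x -> rF (tau x) = rF x.
  by move: x; apply/hT; exact: cycle_id.
apply: (tame_inertia_faithful hvF hrF galF_integral e_gt0 pi_unif pi_root).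
- by apply/hT; exact: mem_cycle.
- have charkF : p \in [pchar kF] by rewrite inE p_pr (residueF_nat hrF) eqxx.
  by rewrite -(dvdn_pcharf charkF) -prime_coprime // coprime_sym.
- by rewrite -expgM mulnC expgM -order_inertia expg_order expg1n.
rewrite (inertia_ratioX hvF hrF galF_integral e_gt0 pi_unif pi_root tau_inert).
by rewrite -hzetabar prim_expr_order.
Qed.

(** Faithfulness of the tame character reduces this to its values. As [ups] fixes [pi], the
    conjugate sends [pi] to [ups (tau pi)], and its character is the Frobenius image
    [zetabar ^+ q]. *)
Lemma tame_conj : (tau ^ ups = tau ^+ q)%g.
Proof.
have [_ _ nTU _] := sdprodP split.
have tau_inert x : val_ge vF 0 x -> rF (tau x) = rF x.
  by move: x; apply/hT; exact: cycle_id.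
have ratioX := inertia_ratioX hvF hrF galF_integral e_gt0 pi_unif pi_root tau_inert.
have /cycleP[j tauE] : (tau ^ ups)%g \in <[tau]>%g.
  by rewrite memJ_norm ?cycle_id // (subsetP nTU) // cycle_id.
rewrite tauE; apply/eqP; rewrite eq_expg_mod_order order_inertia.
rewrite -(eq_prim_root_expr tame_ratio_primitive) hzetabar -ratioX -tauE.
have ups_pi : ups pi = pi by apply: (fixedFieldP (memvf _) pi_fix); exact: cycle_id.
have upsV_pi : (ups^-1)%g pi = pi by rewrite -{1}ups_pi galVK.
rewrite /conjg !galMf upsV_pi -{2}ups_pi -fmorphV -rmorphM /= hU //.
have [nz_pi w_pi] := pi_unif; right.
rewrite (dv_mul hvF) ?fmorph_eq0 ?invr_eq0 // (valV hvF) //.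
by rewrite (gal_val hvF galF_integral e_gt0 pi_unif pi_root) // subrr.
Qed.

End Structure.

(** * Modules over a finite residue field *)

Lemma finField_generator (k : finFieldType) :
  exists2 x : k, x != 0 & forall y, y != 0 -> exists n : nat, y = x ^+ n.
Proof.
have /cyclicP[u uE] := field_unit_group_cyclic [group of [set: {unit k}]%g].
exists (val u) => [|y nz_y]; first by rewrite -unitfE (valP u).
have Uy : y \is a GRing.unit by rewrite unitfE.
have : FinRing.unit k Uy \in <[u]>%g by rewrite -uE inE.
case/cycleP=> n yE; exists n.
by rewrite -[y]/(val (FinRing.unit k Uy)) yE FinRing.val_unitX.
Qed.

Section AdditiveBasis.

Variables (p : nat) (k : fieldType) (d : nat).
Variables (phi : {additive k -> 'rV['F_p]_d}) (psi : 'rV['F_p]_d -> k).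
Hypotheses (phiK : cancel phi psi) (psiK : cancel psi phi).

(** Coordinates in F_p act on [k] through their natural representatives, since [phi] is only an
    additive map. *)
Lemma additive_basis_sum x :
  x = \sum_i psi (delta_mx 0 i) *+ (phi x 0 i : nat).
Proof.
apply: (can_inj phiK); rewrite raddf_sum /= {1}[phi x]row_sum_delta.
apply: eq_bigr => i _; rewrite raddfMn /= psiK -[phi x 0 i in LHS]natr_Zp.
by rewrite scaler_nat.
Qed.

Definition additive_mx (T : k -> k) : 'M['F_p]_d :=
  \matrix_i phi (T (psi (delta_mx 0 i))).

Lemma additive_mxE (T : k -> k) x :
  {morph T : y z / y + z} -> phi x *m additive_mx T = phi (T x).
Proof.
move=> TD; have T0 : T 0 = 0 by apply: (addrI (T 0)); rewrite -TD !addr0.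
have TMn y n : T (y *+ n) = T y *+ n.
  by elim: n => [|n IHn]; rewrite ?mulr0n // !mulrS TD IHn.
rewrite {2}[x]additive_basis_sum (big_morph T TD T0) raddf_sum mulmx_sum_row.
apply: eq_bigr => i _; rewrite rowK TMn raddfMn /= -[phi x 0 i in LHS]natr_Zp.
by rewrite scaler_nat.
Qed.

End AdditiveBasis.

(* A common eigenvector, over the algebraic closure, of all the
   multiplications of [k]: its eigenvalues are the wanted embedding. *)
Lemma finField_embedding (p : nat) (k : finFieldType) (Fbar : closedFieldType)
    (iota : {rmorphism 'F_p -> Fbar}) :
  prime p -> p%:R = 0 :> k -> inhabited {rmorphism k -> Fbar}.
Proof.
move=> p_pr p0.
have [d [phi [[psi phiK psiK] _]]] := finField_additive_basis p_pr p0.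
pose mx (x : k) : 'M[Fbar]_d := map_mx iota (additive_mx phi psi ( *%R x)).
have phi_mx x y : map_mx iota (phi y) *m mx x = map_mx iota (phi (x * y)).
  rewrite -map_mxM; congr map_mx.
  by apply: (additive_mxE phiK psiK) => a b; exact: mulrDr.
have mx_inj (A B : 'M[Fbar]_d) :
    (forall y, map_mx iota (phi y) *m A = map_mx iota (phi y) *m B) -> A = B.
  move=> eqAB; apply/row_matrixP=> i; rewrite !rowE.
  by have := eqAB (psi (delta_mx 0 i)); rewrite psiK map_delta_mx.
have mxM x y : mx (x * y) = mx x *m mx y.
  by apply: mx_inj => z; rewrite mulmxA !phi_mx mulrCA mulrA.
have mxD x y : mx (x + y) = mx x + mx y.
  by apply: mx_inj => z; rewrite mulmxDr !phi_mx mulrDl raddfD map_mxD.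
have mx1 : mx 1 = 1%:M.
  by apply: mx_inj => z; rewrite mulmx1 !phi_mx mul1r.
have [x nz_x gen_x] := finField_generator k.
have d_gt0 : (0 < d)%N.
  case: (posnP d) => // d0; have : (1 : k) = 0.
    by apply: (can_inj phiK); apply/rowP=> i; have := ltn_ord i; rewrite {2}d0.
  by move/eqP; rewrite oner_eq0.
have [a] : exists a, root (char_poly (mx x)) a.
  by apply/closed_rootP; rewrite size_char_poly eqSS -lt0n.
rewrite -eigenvalue_root_char => /eigenvalueP[v va nz_v].
(* A nonzero [y] is a power of the generator [x], so the eigenvector found for [x] serves for
   all. *)
have eig y : exists c, v *m mx y = c *: v.
  have [->|nz_y] := eqVneq y 0.
    have mx0 : mx 0 = 0 by apply: (addrI (mx 0)); rewrite -mxD !addr0.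
    by exists 0; rewrite mx0 mulmx0 scale0r.
  have [n ->] := gen_x y nz_y; exists (a ^+ n).
  elim: n => [|n IHn]; first by rewrite !expr0 mx1 mulmx1 scale1r.
  by rewrite !exprSr mxM mulmxA IHn -scalemxAl va scalerA.
have [j nz_j] : exists j, v 0 j != 0.
  apply/existsP; apply: contraNT nz_v; rewrite negb_exists => /forallP v0.
  by apply/eqP/rowP=> j; rewrite mxE; have := v0 j; rewrite negbK => /eqP.
pose eps0 y := (v *m mx y) 0 j / v 0 j.
have epsE y : v *m mx y = eps0 y *: v.
  by have [c cE] := eig y; rewrite /eps0 cE mxE mulfK.
have eps_inj c c' : c *: v = c' *: v -> c = c'.
  by move/rowP/(_ j); rewrite !mxE => /(mulIf nz_j).
have epsD y z : eps0 (y + z) = eps0 y + eps0 z.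
  by apply: eps_inj; rewrite -epsE mxD mulmxDr !epsE scalerDl.
have epsB : zmod_morphism eps0.
  by move=> y z; apply: (canRL (addrK _)); rewrite -epsD subrK.
have epsM : monoid_morphism eps0.
  split=> [|y z]; first by apply: eps_inj; rewrite -epsE mx1 mulmx1 scale1r.
  apply: eps_inj; rewrite -epsE mulrC mxM mulmxA epsE -scalemxAl epsE.
  by rewrite scalerA mulrC.
pose eps : {rmorphism k -> Fbar} :=
  HB.pack eps0 (GRing.isZmodMorphism.Build k Fbar eps0 epsB)
    (GRing.isMonoidMorphism.Build k Fbar eps0 epsM).
exact: (inhabits eps).
Qed.

(** * Joint eigenspaces *)

Section JointEigenspace.

Variables (R : fieldType) (a b : R).

(* For [A], [B] the actions of tau and ups^s, the rank of this space is
   dim Hom(J_(a, b), -) by Frobenius reciprocity. *)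
Definition joint_eigenspace n (A B : 'M[R]_n) : 'M[R]_n :=
  (eigenspace A a :&: eigenspace B b)%MS.

Definition joint_rank n (A B : 'M[R]_n) : nat := \rank (joint_eigenspace A B).

Lemma joint_eigenspaceP m n (A B : 'M[R]_n) (W : 'M_(m, n)) :
  reflect (W *m A = a *: W /\ W *m B = b *: W) (W <= joint_eigenspace A B)%MS.
Proof.
rewrite sub_capmx; apply: (iffP andP) => [[]|[]].
  by move=> /eigenspaceP ? /eigenspaceP.
by move=> ? ?; split; apply/eigenspaceP.
Qed.

Lemma joint_rank_mono m n (A B : 'M[R]_m) (A' B' : 'M[R]_n) (X : 'M_(m, n)) :
  row_free X -> A *m X = X *m A' -> B *m X = X *m B' ->
  (joint_rank A B <= joint_rank A' B')%N.
Proof.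
move=> freeX AX BX; rewrite /joint_rank -(mxrankMfree _ freeX).
apply: mxrankS; apply/joint_eigenspaceP.
have [WA WB] := joint_eigenspaceP A B _ (submx_refl _).
by rewrite -!mulmxA -AX -BX !mulmxA WA WB -!scalemxAl.
Qed.

Lemma joint_rank_block m n (A B : 'M[R]_m) (A' B' : 'M[R]_n) :
  joint_rank (block_mx A 0 0 A') (block_mx B 0 0 B') =
  (joint_rank A B + joint_rank A' B')%N.
Proof.
rewrite /joint_rank -rank_diag_block_mx; apply/eqP.
rewrite eqn_leq; apply/andP; split; apply: mxrankS; last first.
  have [WA WB] := joint_eigenspaceP A B _ (submx_refl _).
  have [WA' WB'] := joint_eigenspaceP A' B' _ (submx_refl _).
  apply/joint_eigenspaceP; rewrite !mulmx_block !scale_block_mx.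
  by rewrite !mul0mx !mulmx0 !addr0 !add0r !scaler0 WA WB WA' WB'.
apply/row_subP=> i; set v := row i _.
have /joint_eigenspaceP[] : (v <= joint_eigenspace (block_mx A 0 0 A')
  (block_mx B 0 0 B'))%MS by exact: row_sub.
rewrite -[v]hsubmxK !mul_row_block !scale_row_mx !mulmx0 !addr0 !add0r.
move=> /eq_row_mx[vA vA'] /eq_row_mx[vB vB'].
have /submxP[x ->] : (lsubmx v <= joint_eigenspace A B)%MS.
  exact/joint_eigenspaceP.
have /submxP[y ->] : (rsubmx v <= joint_eigenspace A' B')%MS.
  exact/joint_eigenspaceP.
apply/submxP; exists (row_mx x y).
by rewrite mul_row_block !mulmx0 addr0 add0r.
Qed.

End JointEigenspace.

(** * The residue field after extension of scalars *)

Section FrobeniusModule.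

Variables (p : nat) (k : finFieldType) (d : nat).
Variables (phi : {additive k -> 'rV['F_p]_d}) (psi : 'rV['F_p]_d -> k).
Hypotheses (p_pr : prime p) (phiK : cancel phi psi) (psiK : cancel psi phi).
Hypothesis p0 : p%:R = 0 :> k.
Variables (L : fieldType) (iota : {rmorphism 'F_p -> L}).
Variable eps : {rmorphism k -> L}.

Let charL : p \in [pchar L].
Proof. by rewrite inE p_pr -(rmorph_nat eps) p0 rmorph0 eqxx. Qed.

Let card_k : #|k| = (p ^ d)%N.
Proof.
have phi_bij : bijective phi by exists psi.
by rewrite (bij_eq_card phi_bij) card_mx mul1n card_Fp.
Qed.

Let expp_k (x : k) : x ^+ (p ^ d) = x.
Proof. by rewrite -card_k expf_card. Qed.

Let d_gt0 : (0 < d)%N.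
Proof.
by case: (posnP d) (finNzRing_gt1 k) => // d0; rewrite card_k d0 expn0.
Qed.

Let expp_gt0 n : (0 < p ^ n)%N.
Proof. by rewrite expn_gt0 prime_gt0. Qed.

Let iter_frob (x y : L) n : (x + y) ^+ (p ^ n) = x ^+ (p ^ n) + y ^+ (p ^ n).
Proof. by apply: exprDn_pchar; rewrite pnatX pnatE ?charL ?orbT. Qed.

Let iter_frob_sum (I : Type) (s : seq I) (F : I -> L) n :
  (\sum_(i <- s) F i) ^+ (p ^ n) = \sum_(i <- s) F i ^+ (p ^ n).
Proof.
apply: (big_morph (fun x => x ^+ (p ^ n))) => [x y|]; first exact: iter_frob.
by rewrite expr0n (gtn_eqF (expp_gt0 n)).
Qed.

Let iter_frob_nat m n : (m%:R : L) ^+ (p ^ n) = m%:R.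
Proof.
elim: m => [|m IHm]; first by rewrite expr0n (gtn_eqF (expp_gt0 n)).
by rewrite -natr1 iter_frob IHm expr1n.
Qed.

Let iota_nat (u : 'F_p) : iota u = (u : nat)%:R.
Proof. by rewrite -[u in LHS]natr_Zp rmorph_nat. Qed.

(** Row [j] lists the conjugates of the [j]-th basis vector: this is the change of basis identifying
    the extension of scalars of [k] with a product of [d] copies of [L]. *)
Let conj_mx : 'M[L]_d :=
  \matrix_(j, l) (eps (psi (delta_mx 0 j)) ^+ (p ^ l)).

Let phi_conj_mx x (l : 'I_d) :
  (map_mx iota (phi x) *m conj_mx) 0 l = eps x ^+ (p ^ l).
Proof.
rewrite {2}[x](additive_basis_sum phiK psiK) rmorph_sum iter_frob_sum mxE.
apply: eq_bigr => j _; rewrite !mxE iota_nat rmorphMn /= -[eps _ *+ _]mulr_natl exprMn.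
by rewrite iter_frob_nat.
Qed.

(* A column dependency would be a nonzero additive polynomial of degree less
   than [p ^ d] vanishing on [k]. *)
Let conj_mx_free : row_free conj_mx.
Proof.
rewrite row_free_unit -unitmx_tr -row_free_unit -kermx_eq0.
apply/rowV0P=> v /sub_kermxP vC.
have Cv : conj_mx *m v^T = 0 by rewrite -[conj_mx]trmxK -trmx_mul vC trmx0.
pose P : {poly L} := \sum_(l < d) v 0 l *: 'X^(p ^ l).
have P_eps x : P.[eps x] = 0.
  have : (map_mx iota (phi x) *m conj_mx *m v^T) 0 0 = 0.
    by rewrite -mulmxA Cv mulmx0 mxE.
  rewrite mxE => sum0; rewrite -[RHS]sum0 /P horner_sum; apply: eq_bigr => l _.
  by rewrite phi_conj_mx mxE hornerZ hornerXn mulrC.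
have sizeP : (size P <= p ^ d)%N.
  apply: leq_trans (size_sum _ _ _) _; apply/bigmax_leqP=> l _.
  apply: leq_trans (size_scale_leq _ _) _.
  by rewrite size_polyXn ltn_exp2l ?prime_gt1.
have P0 : P = 0.
  apply/eqP/negPn/negP=> nzP.
  have : (size [seq eps x | x <- enum k] < size P)%N.
    apply: max_poly_roots nzP _ _; first by apply/allP=> _ /mapP[x _ ->]; exact/rootP.
    by rewrite map_inj_uniq ?enum_uniq //; exact: fmorph_inj.
  by rewrite size_map -cardE card_k ltnNge sizeP.
apply/rowP=> l; have := congr1 (fun R : {poly L} => R`_(p ^ l)) P0.
rewrite coef0 coef_sum (bigD1 l) //= coefZ coefXn eqxx mulr1 mxE.
rewrite big1 ?addr0 // => j neq_jl; rewrite coefZ coefXn.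
by rewrite eqn_exp2l ?prime_gt1 // eq_sym (inj_eq val_inj) (negbTE neq_jl) mulr0.
Qed.

Section Count.

Variables (c : k) (D : nat) (T U : 'M['F_p]_d) (a b : L).
Hypotheses (D_gt0 : (0 < D)%N) (D_d : (D %| d)%N).
Hypothesis TP : forall x, phi (c * x) = phi x *m T.
Hypothesis UP : forall x, phi (x ^+ (p ^ D)) = phi x *m U.
Hypotheses (aD : a ^+ (p ^ D) = a) (bD : b ^+ (d %/ D) = 1).

Let D_le_d : (D <= d)%N. Proof. exact: dvdn_leq. Qed.

Let eig l : L := eps c ^+ (p ^ l).

Let shift (l : 'I_d) : 'I_d := Ordinal (ltn_pmod (l + D) d_gt0).

Let T_conj : map_mx iota T *m conj_mx = conj_mx *m diag_mx (\row_l eig l).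
Proof.
apply/matrixP=> j l; rewrite mul_mx_diag !mxE.
have := phi_conj_mx (c * psi (delta_mx 0 j)) l.
rewrite TP psiK -rowE map_row -row_mul mxE [LHS]mxE.
by rewrite rmorphM exprMn mulrC.
Qed.

Let eps_mod y n : eps y ^+ (p ^ n) = eps y ^+ (p ^ (n %% d)).
Proof.
rewrite {1}(divn_eq n d); elim: (n %/ d)%N => // m IHm.
by rewrite mulSn -addnA expnD exprM -rmorphXn expp_k.
Qed.

Let shift_mx : 'M[L]_d := \matrix_(i, l) (i == shift l)%:R.

Let shift_mxE m (A : 'M[L]_(m, d)) i l : (A *m shift_mx) i l = A i (shift l).
Proof.
rewrite mxE (bigD1 (shift l)) //= mxE eqxx mulr1 big1 ?addr0 // => j neq_j.
by rewrite mxE (negbTE neq_j) mulr0.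
Qed.

Let U_conj : map_mx iota U *m conj_mx = conj_mx *m shift_mx.
Proof.
apply/matrixP=> j l; rewrite shift_mxE [RHS]mxE.
have := phi_conj_mx (psi (delta_mx 0 j) ^+ (p ^ D)) l.
rewrite UP psiK -rowE map_row -row_mul mxE => ->.
by rewrite rmorphXn -exprM -expnD addnC eps_mod.
Qed.

Let S := [set l : 'I_D | eig l == a].

(** In the new coordinates a joint eigenvector satisfies [y_(l + D) = b y_l] and vanishes where
    [eig l] differs from [a]. Each starting index in [S] yields one, supported on its class modulo
    [D]. *)
Let solutions : 'M[L]_(#|S|, d) :=
  \matrix_(i < #|S|, l < d) ((l %% D == enum_val i)%N%:R * b ^+ (l %/ D)).

Let eigD l n : eig l = a -> eig (l + n * D)%N = a.
Proof.
move=> la; elim: n => [|n IHn]; first by rewrite addn0.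
rewrite mulSn addnCA addnC /eig expnD exprM.
by rewrite -/(eig (l + n * D)%N) IHn.
Qed.

Let solutions_free : row_free solutions.
Proof.
apply/row_freeP; exists (\matrix_(l < d, i < #|S|) (l == widen_ord D_le_d (enum_val i))%:R).
apply/matrixP=> i i'; rewrite !mxE (bigD1 (widen_ord D_le_d (enum_val i'))) //=.
rewrite !mxE eqxx mulr1 big1 ?addr0 => [|l neq_l]; last first.
  by rewrite !mxE (negbTE neq_l) mulr0.
rewrite /= modn_small ?divn_small ?ltn_ord // mulr1.
by rewrite (inj_eq val_inj) (inj_eq enum_val_inj) eq_sym.
Qed.

Let solutions_eig : solutions *m diag_mx (\row_l eig l) = a *: solutions.
Proof.
apply/matrixP=> i l; rewrite mul_mx_diag !mxE mulrC.
have [li|_] := eqVneq (l %% D)%N (enum_val i); last by rewrite !mul0r !mulr0.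
rewrite [X in eig X](divn_eq l D) addnC eigD // li.
by have := enum_valP i; rewrite inE => /eqP.
Qed.

Let solutions_shift : solutions *m shift_mx = b *: solutions.
Proof.
apply/matrixP=> i l; rewrite shift_mxE !mxE /= modn_dvdm // modnDr.
rewrite mulrCA -exprS; congr (_ * _).
have [lt_d|ge_d] := ltnP (l + D) d.
  by rewrite modn_small // divnDr ?dvdnn // divnn D_gt0 addn1.
have -> : ((l + D) %% d = l + D - d)%N.
  rewrite -{1}(subnK ge_d) modnDr modn_small //.
  by have := ltn_ord l; lia.
have dE : (d %/ D * D = d)%N by rewrite divnK.
(* Wrapping around past [d] loses the factor [b ^+ (d %/ D)], which is 1. *)
rewrite -[LHS]mulr1 -bD -exprD; congr (_ ^+ _).
rewrite -divnDr // subnK // divnDr ?dvdnn // divnn D_gt0 addn1.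
by [].
Qed.

(** Conjugation by [conj_mx] turns [T] into a diagonal matrix and [U] into a cyclic shift; the rows
    of [solutions] are then a basis of the joint eigenspace. *)
Lemma joint_rank_frobenius :
  joint_rank a b (map_mx iota T) (map_mx iota U) =
  (\sum_(l < D) (eps c ^+ (p ^ l) == a))%N.
Proof.
transitivity #|S|; last by rewrite -sum1dep_card big_mkcond.
have unitC : conj_mx \in unitmx by rewrite -row_free_unit.
rewrite /joint_rank -(mxrankMfree _ conj_mx_free) -(eqP solutions_free).
apply/eqP; rewrite eqn_leq; apply/andP; split; apply: mxrankS; last first.
  rewrite -[solutions](mulmxKV unitC); apply: submxMr.
  apply/joint_eigenspaceP; split; apply: (row_free_inj conj_mx_free).
    by rewrite /= -[LHS]mulmxA T_conj mulmxA -scalemxAl !mulmxKV // solutions_eig.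
  by rewrite /= -[LHS]mulmxA U_conj mulmxA -scalemxAl !mulmxKV // solutions_shift.
apply/row_subP=> i; rewrite row_mul; set y := row i _; set z := y *m conj_mx.
have /joint_eigenspaceP[yT yU] :
    (y <= joint_eigenspace a b (map_mx iota T) (map_mx iota U))%MS.
  exact: row_sub.
(* Coordinates are indexed by all naturals modulo [d], so the shift relation needs no case
   distinction. *)
pose zn n := z 0 (Ordinal (ltn_pmod n d_gt0)).
have znE (l : 'I_d) : z 0 l = zn l.
  by rewrite /zn; congr (z 0 _); apply: val_inj; rewrite /= modn_small.
have z_eig n : zn n * eig (n %% d) = a * zn n.
  have : z *m diag_mx (\row_l eig l) = a *: z.
    by rewrite /z -mulmxA -T_conj mulmxA yT -scalemxAl.
  move/rowP/(_ (Ordinal (ltn_pmod n d_gt0))).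
  by rewrite mul_mx_diag [LHS]mxE [RHS]mxE [X in _ * X = _]mxE.
have z_shift n : zn (n + D)%N = b * zn n.
  have : z *m shift_mx = b *: z.
    by rewrite /z -mulmxA -U_conj mulmxA yU -scalemxAl.
  move/rowP/(_ (Ordinal (ltn_pmod n d_gt0))); rewrite shift_mxE [RHS]mxE => <-.
  by rewrite /zn; congr (z 0 _); apply: val_inj; rewrite /= modnDml.
have z_shiftn n m : zn (n + m * D)%N = b ^+ m * zn n.
  elim: m => [|m IHm]; first by rewrite addn0 mul1r.
  by rewrite mulSn addnCA addnC z_shift IHm exprS mulrA.
have zl l : zn l = b ^+ (l %/ D)%N * zn (l %% D)%N.
  by rewrite -z_shiftn addnC -divn_eq.
apply/submxP; exists (\row_(j < #|S|) zn (enum_val j)); apply/rowP=> l.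
rewrite znE zl mxE.
have lt_lD : (l %% D < D)%N by rewrite ltn_pmod.
have [|nS] := boolP (Ordinal lt_lD \in S) => [lS|].
  rewrite (bigD1 (enum_rank_in lS (Ordinal lt_lD))) //= !mxE enum_rankK_in //=.
  rewrite eqxx mul1r mulrC big1 ?addr0 // => j neq_j; rewrite !mxE.
  case: eqP => [lj|_]; last by rewrite mul0r mulr0.
  case/eqP: neq_j; apply: enum_val_inj; rewrite enum_rankK_in //.
  by apply: val_inj; rewrite /= lj.
rewrite big1 => [|j _]; last first.
  rewrite !mxE; case: eqP => [lj|_]; last by rewrite mul0r mulr0.
  case/negP: nS; have := enum_valP j; rewrite !inE /= lj //.
(* Outside [S] the eigenvalue of [T] at the starting index is not [a], so that coordinate is 0. *)
apply/eqP; rewrite mulf_eq0; apply/orP; right.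
have lt_ld : (l %% D < d)%N := leq_trans lt_lD D_le_d.
have := z_eig (l %% D)%N; rewrite (modn_small lt_ld) mulrC.
move/eqP; rewrite -subr_eq0 -mulrBl mulf_eq0 subr_eq0.
by move: nS; rewrite inE /= => /negbTE ->.
Qed.

End Count.

End FrobeniusModule.

(** * Multiplicity of an induced representation *)

Section Multiplicity.

Variables (R : fieldType) (gT : finGroupType) (G : {group gT}).
Implicit Types rG rJ : representation R G.

Lemma joint_rank_big_dadd (I : Type) (s : seq I) (P : pred I)
    (rG : I -> representation R G) a b x y :
  joint_rank a b ((\big[dadd_grepr/grepr0]_(i <- s | P i) rG i) x)
    ((\big[dadd_grepr/grepr0]_(i <- s | P i) rG i) y) =
  (\sum_(i <- s | P i) joint_rank a b (rG i x) (rG i y))%N.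
Proof.
elim: s => [|i s IHs].
  by rewrite !big_nil; apply/eqP; rewrite -leqn0 /joint_rank rank_leq_row.
rewrite !big_cons; case: (P i) => //; rewrite -IHs.
exact: joint_rank_block.
Qed.

Lemma rsim_submod_hom rG n (rJ : mx_representation R G n) (B : 'M_(n, rdegree rG))
    (U : 'M_(rdegree rG)) (modU : mxmodule rG U) :
  row_free B -> (U :=: B)%MS ->
  (forall x, x \in G -> rJ x *m B = B *m rG x) ->
  mx_rsim (submod_repr modU) rJ.
Proof.
move=> freeB UB homB; have BU : (B <= U)%MS by rewrite UB.
apply: mx_rsim_sym; exists (in_submod U B).
- by rewrite UB; apply/esym/eqP.
- by rewrite /row_free mxrank_in_submod.
move=> x Gx; rewrite -in_submodJ // -homB //.
by rewrite /in_submod /= !mulmxA.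
Qed.

(** The upper bound: the joint rank is additive on direct sums and monotone under injective
    morphisms. *)
Lemma joint_rank_copies rG rJ m a b x y : x \in G -> y \in G ->
  contains_copies rG rJ m ->
  (m * joint_rank a b (rJ x) (rJ y) <= joint_rank a b (rG x) (rG y))%N.
Proof.
move=> Gx Gy [U [modU /mx_rsim_sym[B _ freeB homB]]].
have -> : (m * joint_rank a b (rJ x) (rJ y))%N =
    joint_rank a b (muln_grepr rJ m x) (muln_grepr rJ m y).
  by rewrite /muln_grepr joint_rank_big_dadd sum_nat_const card_ord.
have hom z : z \in G ->
    muln_grepr rJ m z *m val_submod B = val_submod B *m rG z.
  by move=> Gz; rewrite -(val_submodJ modU) // -homB // /val_submod /= mulmxA.
have freeX : row_free (val_submod B) by rewrite /row_free /val_submod /= mxrankMfree ?row_base_free.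
apply: (joint_rank_mono _ _ freeX); exact: hom.
Qed.

Section Induced.

Variables (tau ups : gT) (q s : nat) (A : {group gT}) (sAG : A \subset G).
Hypothesis AE : A = (<[tau]> <*> <[(ups ^+ s)%g]>)%G.
Hypothesis s_gt0 : (0 < s)%N.
Hypothesis GE : (<[tau]> * <[ups]>)%g = G.
Hypothesis tau_conj : (tau ^ ups = tau ^+ q)%g.
Variables (alpha beta : R) (V : mx_representation R A 1).
Hypotheses (V_tau : V tau = alpha%:M) (V_ups : V (ups ^+ s)%g = beta%:M).
Hypothesis alpha_inj : {in [pred i | (i < s)%N] &,
  injective (fun i => alpha ^+ (q ^ i))}.

Let J := ind_repr sAG V.

Let A_tau : tau \in A.
Proof. by rewrite AE /= mem_gen // inE cycle_id. Qed.

Let A_ups : (ups ^+ s)%g \in A.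
Proof. by rewrite AE /= mem_gen // inE cycle_id orbT. Qed.

Let G_tau : tau \in G. Proof. exact: (subsetP sAG). Qed.

Let G_ups : ups \in G.
Proof. by rewrite -GE (subsetP (mulG_subr _ _)) ?cycle_id. Qed.

Let G_upsX n : (ups ^+ n)%g \in G. Proof. exact: groupX. Qed.

Let coset_cover g : g \in G -> exists2 j, (j < s)%N & (g * ups ^+ j)%g \in A.
Proof.
rewrite -GE => /mulsgP[_ _ /cycleP[i ->] /cycleP[n ->] ->].
(* The representative of [- n] modulo [s]; the outer reduction handles [n] divisible by [s]. *)
exists ((s - n %% s) %% s)%N; first exact: ltn_pmod.
rewrite -mulgA -expgD; apply: groupM; first exact: groupX.
suff /dvdnP[m ->] : (s %| n + (s - n %% s) %% s)%N by rewrite mulnC expgM groupX.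
rewrite /dvdn modnDmr -modnDml subnKC ?modnn //.
by apply: ltnW; exact: ltn_pmod.
Qed.

(** An upper bound suffices: set against the rank of the [s] translates, it forces [hom_mx] below to
    be row free. *)
Let card_ind : (#|ind_index A G 1| <= s)%N.
Proof.
rewrite card_prod card_ord muln1 card_sig.
pose c (j : 'I_s) := (A :* (ups ^+ j)^-1)%g.
apply: leq_trans (_ : #|[set c j | j : 'I_s]| <= _)%N; last first.
  by rewrite -[X in (_ <= X)%N]card_ord; exact: leq_imset_card.
apply: subset_leq_card; apply/subsetP=> _ /rcosetsP[g Gg ->].
have [j lt_js Aj] := coset_cover Gg.
apply/imsetP; exists (Ordinal lt_js) => //=.
by apply/rcoset_eqP; rewrite mem_rcoset invgK.
Qed.

Section InModule.

Variables (rG : representation R G).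

Let joint := joint_eigenspace alpha beta (rG tau) (rG (ups ^+ s)%g).

(** The elements of [A] acting on [W] through the scalar [V] form a subgroup containing both
    generators. *)
Let rG_A m (W : 'M_(m, rdegree rG)) a : (W <= joint)%MS -> a \in A ->
  W *m rG a = V a 0 0 *: W.
Proof.
move=> /joint_eigenspaceP[Wt Wu].
pose S := [set x in A | W *m rG x == V x 0 0 *: W].
have gS : group_set S.
  apply/group_setP; split=> [|x y].
    by rewrite inE group1 !repr_mx1 mulmx1 mxE scale1r eqxx.
  rewrite !inE => /andP[Ax /eqP Wx] /andP[Ay /eqP Wy]; rewrite groupM //=.
  rewrite !repr_mxM ?(subsetP sAG) // mulmxA Wx -scalemxAl Wy scalerA.
  by rewrite mxE big_ord1.
suff /subsetP sAS : A \subset S by move/sAS; rewrite inE => /andP[_ /eqP].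
rewrite {1}AE /= -[S]/(gval (Group gS)) join_subG !cycle_subG /=.
by rewrite !inE A_tau A_ups V_tau V_ups !mxE Wt Wu !eqxx.
Qed.

(** The conjugation relation gives [ups^-j tau = tau^(q^j) ups^-j], read from left to right on row
    vectors. *)
Let shift_eig m (W : 'M_(m, rdegree rG)) j : (W <= joint)%MS ->
  (W *m rG (ups ^- j)%g <= eigenspace (rG tau) (alpha ^+ (q ^ j)))%MS.
Proof.
move=> Wj; apply/eigenspaceP; have [Wt _] := joint_eigenspaceP _ _ _ _ _ Wj.
have GV : (ups ^- j)%g \in G by rewrite groupV.
have tauJ : (tau ^ (ups ^+ j) = tau ^+ (q ^ j))%g.
  elim: (j) => [|i IHi]; first by rewrite conjg1.
  by rewrite expgSr conjgM IHi conjXg tau_conj -expgM expnSr mulnC.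
have -> : W *m rG (ups ^- j)%g *m rG tau =
    W *m rG (tau ^+ (q ^ j))%g *m rG (ups ^- j)%g.
  rewrite -!mulmxA -!repr_mxM ?groupX // -tauJ; congr (_ *m rG _).
  by rewrite conjgE !mulgA mulgK.
rewrite scalemxAl; congr (_ *m _); elim: (q ^ j)%N => [|n IHn].
  by rewrite repr_mx1 mulmx1 scale1r.
by rewrite expgSr exprS repr_mxM ?groupX // mulmxA IHn -scalemxAl Wt scalerA mulrC.
Qed.

(* The translates of a joint eigenspace lie in distinct eigenspaces of [tau]. *)
Let rank_translates m (W : 'M_(m, rdegree rG)) : row_free W -> (W <= joint)%MS ->
  \rank (\sum_(j < s) <<W *m rG (ups ^- j)%g>>)%MS = (s * m)%N.
Proof.
move=> freeW Wj.
have dx : mxdirect (\sum_(j < s) <<W *m rG (ups ^- j)%g>>)%MS.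
  have dxE : mxdirect (\sum_(j < s) eigenspace (rG tau) (alpha ^+ (q ^ j)))%MS.
    apply: mxdirect_sum_eigenspace => i j _ _ /alpha_inj eq_ij.
    by apply: val_inj; apply: eq_ij; rewrite inE.
  apply/mxdirect_sumsP=> i _; apply/eqP; rewrite -submx0.
  have /mxdirect_sumsP/(_ i isT) cap0 := dxE; rewrite -[X in (_ <= X)%MS]cap0.
  apply: capmxS; first by rewrite genmxE shift_eig.
  apply/sumsmx_subP=> j neq; apply: (sumsmx_sup j) => //.
  by rewrite genmxE shift_eig.
rewrite (mxdirectP dx) /= (eq_bigr (fun=> m)) ?sum_nat_const ?card_ord // => j _.
rewrite genmxE mxrankMfree; first exact/eqP.
by rewrite row_free_unit repr_mx_unit ?groupV.
Qed.

(** The morphism from [J] that Frobenius reciprocity attaches to [y]: the basis vector of a coset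
    with representative [x] goes to [y x]. *)
Let hom_mx (y : 'rV_(rdegree rG)) : 'M_(#|ind_index A G 1|, rdegree rG) :=
  \matrix_i (y *m rG (ind_rep (enum_val i))).

Let hom_mx_hom y g : (y <= joint)%MS -> g \in G ->
  J g *m hom_mx y = hom_mx y *m rG g.
Proof.
move=> yj Gg; apply/row_matrixP=> i; rewrite !row_mul rowK.
set x := ind_rep (enum_val i); have Gx : x \in G by exact: ind_rep_in.
have XC : (A :* (x * g))%g \in rcosets A G.
  by apply/rcosetsP; exists (x * g)%g; rewrite ?groupM.
pose C : {B | B \in rcosets A G} := exist (fun B => B \in rcosets A G) _ XC.
pose j0 := enum_rank ((C, ord0) : ind_index A G 1).
set z := ind_rep (enum_val j0).
have Az : (x * g * z^-1)%g \in A.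
  rewrite -mem_rcoset; apply/rcoset_eqP.
  by rewrite /z enum_rankK /ind_rep /= rcoset_repr.
rewrite mulmx_sum_row (bigD1 j0) //= big1 ?addr0 => [|j neq_j]; last first.
  rewrite mxE [ind_mx _ _ _ _ _]mxE /= -/x.
  case: ifP => [Aj|_]; last by rewrite scale0r.
  case/eqP: neq_j; rewrite -(enum_valK j); congr enum_rank.
  move: Aj; set c := enum_val j; case: c => B o /= Aj.
  rewrite (ord1 o); congr (_, _); apply: val_inj => /=.
  rewrite -[LHS](ind_repK B); apply/esym/rcoset_eqP.
  by rewrite mem_rcoset.
rewrite rowK mxE [ind_mx _ _ _ _ _]mxE /= -/x -/z Az -mulmxA -repr_mxM //.
set a := (x * g * z^-1)%g in Az *; have -> : (x * g = a * z)%g by rewrite mulgKV.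
rewrite repr_mxM ?(subsetP sAG _ Az) ?ind_rep_in // mulmxA (rG_A yj Az).
by rewrite -scalemxAl; congr (V _ _ _ *: _); exact: ord1.
Qed.

(** The element [ups ^- j] differs from its coset representative by an element of [A], which scales
    [y]. *)
Let translate_hom y j : (y <= joint)%MS -> (y *m rG (ups ^- j)%g <= hom_mx y)%MS.
Proof.
move=> yj; have GV : (ups ^- j)%g \in G by rewrite groupV.
have XC : (A :* ups ^- j)%g \in rcosets A G.
  by apply/rcosetsP; exists (ups ^- j)%g.
pose C : {B | B \in rcosets A G} := exist (fun B => B \in rcosets A G) _ XC.
pose c : ind_index A G 1 := (C, ord0).
set x := ind_rep c; have Gx : x \in G by exact: ind_rep_in.
have Ax : (ups ^- j * x^-1)%g \in A.
  by rewrite -mem_rcoset; apply/rcoset_eqP; rewrite /x /ind_rep /= rcoset_repr.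
rewrite -[(ups ^- j)%g](mulgKV x) repr_mxM ?(subsetP sAG _ Ax) //.
rewrite mulmxA (rG_A yj) // -scalemxAl scalemx_sub //.
suff -> : y *m rG x = row (enum_rank c) (hom_mx y) by exact: row_sub.
by rewrite rowK enum_rankK.
Qed.

Let hom_mx_free y : y != 0 -> (y <= joint)%MS -> row_free (hom_mx y).
Proof.
move=> nz_y yj; rewrite -row_leq_rank; apply: leq_trans card_ind _.
have free_y : row_free y by rewrite /row_free rank_rV nz_y.
rewrite -[X in (X <= _)%N]muln1 -(rank_translates free_y yj).
by apply/mxrankS/sumsmx_subP=> j _; rewrite genmxE; exact: translate_hom.
Qed.

(** Each of the [m] basis vectors of the joint eigenspace spans a copy of [J]. Their sum is direct
    by counting: it contains [s * m] independent translates, while the copies have dimension at most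
    [s] each. *)
Lemma induced_copies :
  contains_copies rG J (joint_rank alpha beta (rG tau) (rG (ups ^+ s)%g)).
Proof.
set m := joint_rank _ _ _ _; pose W : 'M_(m, _) := row_base joint.
have freeW : row_free W by exact: row_base_free.
have Wj : (W <= joint)%MS by rewrite eq_row_base.
have yj c : (row c W <= joint)%MS by apply: submx_trans Wj; exact: row_sub.
have nzy c : row c W != 0.
  apply/eqP=> Wc0; have /(row_free_inj freeW)/rowP/(_ c) :
    delta_mx 0 c *m W = (0 : 'rV_m) *m W by rewrite -rowE Wc0 mul0mx.
  by rewrite !mxE !eqxx => /eqP; rewrite oner_eq0.
pose U (c : 'I_m) := <<hom_mx (row c W)>>%MS.
have modU c : mxmodule rG (U c).
  apply/mxmoduleP=> x Gx; rewrite /U genmxE (eqmxMr _ (genmxE _)).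
  by rewrite -hom_mx_hom ?submxMl.
have modS : mxmodule rG (\sum_c U c)%MS by exact: sumsmx_module.
exists (\sum_c U c)%MS, modS; apply: (mx_rsim_dsum (modU := modU) _ (eqmx_refl _)).
- apply/mxdirectP/eqP; rewrite eqn_leq; apply/andP; split.
    exact: mxrank_sum_leqif.
  apply: (@leq_trans (s * m)).
    rewrite mulnC -[X in (X * s)%N]card_ord -sum_nat_const; apply: leq_sum => c _.
    by rewrite /= genmxE; exact: leq_trans (rank_leq_row _) card_ind.
  rewrite -(rank_translates freeW Wj); apply/mxrankS/sumsmx_subP=> j _.
  rewrite genmxE; apply/row_subP=> c; rewrite row_mul; apply: (sumsmx_sup c) => //.
  by rewrite genmxE translate_hom.
move=> c; apply: (rsim_submod_hom (B := hom_mx (row c W))).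
- exact: hom_mx_free.
- exact: genmxE.
by move=> x Gx; exact: hom_mx_hom.
Qed.

End InModule.

(** The basis vector at the coset [A] itself is a joint eigenvector. Positivity is all the upper
    bound on the multiplicity requires. *)
Let joint_rank_induced :
  (0 < joint_rank alpha beta (J tau) (J (ups ^+ s)%g))%N.
Proof.
have AC : gval A \in rcosets A G by apply/rcosetsP; exists 1%g; rewrite ?mulg1.
pose C : {B | B \in rcosets A G} := exist (fun B => B \in rcosets A G) _ AC.
pose c : ind_index A G 1 := (C, ord0).
pose v : 'rV[R]_(#|ind_index A G 1|) := delta_mx 0 (enum_rank c).
have vA a : a \in A -> v *m J a = V a 0 0 *: v.
  move=> Aa; rewrite -rowE; apply/rowP=> j; rewrite !mxE eqxx /= enum_rankK.
  rewrite {1 2}/ind_rep /= repr_group mul1g groupMl // groupV.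
  have [->|neq_j] := eqVneq j (enum_rank c).
    rewrite enum_rankK /ind_rep /= repr_group group1 invg1 mulg1 mulr1.
    by rewrite mul1g; congr (V _ _ _); exact: ord1.
  rewrite mulr0; case: ifP => // Aj; case/eqP: neq_j.
  rewrite -(enum_valK j); congr enum_rank; move: Aj; rewrite /ind_rep.
  set b := enum_val j; case: b => B o /= Aj; rewrite (ord1 o); congr (_, _); apply: val_inj => /=.
  by rewrite -[LHS](ind_repK B); exact: rcoset_id.
rewrite lt0n mxrank_eq0; apply/negP=> /eqP joint0.
have : (v <= joint_eigenspace alpha beta (J tau) (J (ups ^+ s)%g))%MS.
  by apply/joint_eigenspaceP; rewrite !vA // V_tau V_ups !mxE.
rewrite joint0 submx0 => /eqP/rowP/(_ (enum_rank c)).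
by rewrite !mxE !eqxx => /eqP; rewrite oner_eq0.
Qed.

Lemma induced_multiplicity rG :
  is_multiplicity rG J (joint_rank alpha beta (rG tau) (rG (ups ^+ s)%g)).
Proof.
split=> [|m copies]; first exact: induced_copies.
apply: leq_trans (joint_rank_copies alpha beta G_tau (G_upsX s) copies).
by rewrite leq_pmulr // joint_rank_induced.
Qed.

End Induced.

End Multiplicity.

(** * Counting exponents *)

(** Over [e] consecutive exponents the powers of [z] run once through all [e]-th roots of unity, so
    each block contributes 1. *)
Lemma prim_root_block_count (L : fieldType) (e n m : nat) (z a : L) :
  e.-primitive_root z -> a ^+ e = 1 ->
  (\sum_(m <= i < m + e * n) (z ^+ i == a) = n)%N.
Proof.
move=> z_prim a_e; elim: n m => [|n IHn] m.
  by rewrite muln0 addn0 big_geq.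
rewrite mulnS (big_cat_nat (n := m + e)) ?leq_addr ?leq_add2l ?leq_addr //=.
rewrite addnA IHn -{1}[m]add0n big_addn addKn big_mkord.
have e_gt0 := prim_order_gt0 z_prim.
have nz_z : z != 0.
  apply: contra_eq_neq (prim_expr_order z_prim) => ->.
  by rewrite expr0n gtn_eqF // eq_sym oner_eq0.
have b_e : (a / z ^+ m) ^+ e = 1.
  by rewrite exprMn a_e mul1r exprVn exprAC (prim_expr_order z_prim) expr1n invr1.
have [j jE] := prim_rootP z_prim b_e.
rewrite (bigD1 j) //= exprD -jE divfK ?expf_neq0 // eqxx big1 // => i neq_ij.
apply/eqP; rewrite eqb0; apply: contraNneq neq_ij => zi.
have : i == j %[mod e].
  by rewrite -(eq_prim_root_expr z_prim) -jE -zi exprD mulfK ?expf_neq0.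
by rewrite !modn_small // => /eqP ij; apply/eqP/val_inj.
Qed.

Lemma sum_coprime_multiples (p m : nat) (F : nat -> nat) : prime p ->
  (\sum_(0 <= i < (p * m).+1 | coprime i p) F i + \sum_(0 <= j < m.+1) F (p * j)
   = \sum_(0 <= i < (p * m).+1) F i)%N.
Proof.
move=> p_pr; have p_gt0 := prime_gt0 p_pr; elim: m => [|m IHm].
  (* The index 0 is not coprime to [p]; it is counted among the multiples, as [p * 0]. *)
  rewrite muln0 !big_nat1 muln0 big_mkcond big_nat1 coprime_sym /coprime gcdn0.
  by rewrite gtn_eqF ?prime_gt1.
have le_pm : ((p * m).+1 <= (p * m.+1).+1)%N by rewrite ltnS leq_mul2l leqnSn orbT.
rewrite [X in (_ + X)%N]big_nat_recr //= [in RHS](big_cat_nat _ le_pm) //=.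
rewrite [X in (X + _)%N](big_cat_nat _ le_pm) //=.
rewrite -IHm addnACA; congr addn.
have topE : (p * m.+1 = (p * m + p.-1).+1)%N by rewrite mulnS -addnS prednK // addnC.
have le_top : ((p * m).+1 <= (p * m + p.-1).+1)%N by rewrite ltnS leq_addr.
rewrite topE [in RHS]big_nat_recr // [X in (X + _)%N]big_mkcond.
rewrite [X in (X + _)%N]big_nat_recr //= -topE.
have -> : coprime (p * m.+1) p = false.
  by rewrite coprimeMl /coprime gcdnn gtn_eqF ?prime_gt1.
rewrite addn0; congr addn.
apply: eq_big_nat => i /andP[lt_i i_lt].
suff -> : coprime i p by [].
rewrite coprime_sym prime_coprime //; apply/negP=> /dvdnP[j ij].
rewrite ij (mulnC j) in lt_i i_lt; move: lt_i; rewrite ltn_pmul2l // => lt_mj.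
have : (p * m.+1 <= p * j)%N by rewrite leq_pmul2l.
by rewrite leqNgt i_lt.
Qed.

(* The multiples of [p] in the range cancel telescopically: replacing [i] by
   [p j] amounts to replacing [l] by [l + 1]. *)
Lemma tame_exponent_count (L : fieldType) (p e n m D N : nat) (z a : L) :
  prime p -> e.-primitive_root z -> coprime e p -> a ^+ e = 1 ->
  (p.-1 * m = e * n)%N -> z ^+ (p ^ (D * N)) = z -> (0 < N)%N -> a ^+ (p ^ D) = a ->
  (\sum_(0 <= i < (p * m).+1 | coprime i p)
     \sum_(l < D) ((z ^+ i) ^+ (p ^ l) == a) = D * n)%N.
Proof.
move=> p_pr z_prim e_p a_e mE z_DN N_gt0 a_D; have p_gt0 := prime_gt0 p_pr.
pose F l i : nat := (z ^+ i) ^+ (p ^ l) == a.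
pose A X l := (\sum_(0 <= i < X.+1) F l i)%N.
have a_DM M : a ^+ (p ^ (D * M)) = a.
  by elim: M => [|M IHM]; rewrite ?muln0 ?expr1 // mulnS expnD exprM a_D.
(* This closes the telescope: some iterate of the [p ^ D]-power map fixes [z ^+ i], and every
   iterate fixes [a], so level [D] and level 0 impose the same condition. *)
have F_D i : F D i = F 0%N i.
  congr nat_of_bool; rewrite expn0 expr1; apply/eqP/eqP=> [zi|->//].
  have : (z ^+ i) ^+ (p ^ (D * N)) = z ^+ i by rewrite exprAC z_DN.
  by rewrite -(prednK N_gt0) mulnS expnD exprM zi a_DM.
have split l : (\sum_(0 <= i < (p * m).+1 | coprime i p) F l i + A m l.+1 =
    A (p * m) l)%N.
  rewrite /A -sum_coprime_multiples //; congr addn; apply: eq_bigr => j _.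
  by rewrite /F -!exprM expnS mulnA (mulnC j).
have block l : (A (p * m) l = A m l + n)%N.
  rewrite /A (big_cat_nat (n := m.+1)) //= ?ltnS ?leq_pmull //; congr addn.
  have -> : (p * m).+1 = (m.+1 + e * n)%N.
    by rewrite -mE -{1}(prednK p_gt0) mulSn addSn addnC.
  rewrite -[RHS](@prim_root_block_count _ e n m.+1 (z ^+ (p ^ l)) a) //.
    by apply: eq_bigr => i _; rewrite /F exprAC.
  rewrite (prim_root_exp_coprime _ z_prim) coprime_sym.
  by rewrite coprimeXr.
rewrite exchange_big /= -/F.
have telescope : (\sum_(l < D) A m l.+1 = \sum_(l < D) A m l)%N.
  have A_D : A m D = A m 0%N by apply: eq_bigr => i _; exact: F_D.
  apply/eqP; rewrite -(eqn_add2l (A m 0%N)) -(big_ord_recl D (fun l => A m l)).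
  by rewrite big_ord_recr /= A_D addnC.
apply/eqP; rewrite -(eqn_add2r (\sum_(l < D) A m l)%N) -{1}telescope -big_split /=.
rewrite (eq_bigr (fun l : 'I_D => A m l + n)%N) => [|l _]; last first.
  by rewrite -block -split.
by rewrite big_split /= sum_nat_const card_ord addnC.
Qed.

Lemma joint_rank_base_change_dadd (R S : fieldType) (h : {rmorphism R -> S})
    (gT : finGroupType) (G : {group gT}) (I : Type) (s : seq I) (P : pred I)
    (rG : I -> representation R G) a b x y :
  joint_rank a b (base_change h (\big[dadd_grepr/grepr0]_(i <- s | P i) rG i) x)
    (base_change h (\big[dadd_grepr/grepr0]_(i <- s | P i) rG i) y) =
  (\sum_(i <- s | P i)
     joint_rank a b (map_mx h (rG i x)) (map_mx h (rG i y)))%N.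
Proof.
elim: s => [|i s IHs].
  by rewrite !big_nil; apply/eqP; rewrite -leqn0 /joint_rank rank_leq_row.
rewrite !big_cons; case: (P i) => //; rewrite -IHs -joint_rank_block.
by rewrite /= /map_repr_mx /= !map_block_mx !map_mx0.
Qed.

Lemma mult_order_dvd (t q s f : nat) :
  is_mult_order t q s -> q ^ f = 1 %[mod t] -> (s %| f)%N.
Proof.
case=> s_gt0 q_s s_min q_f; rewrite /dvdn; apply/negPn/negP; rewrite -lt0n => r_gt0.
have q_r : q ^ (f %% s) = 1 %[mod t].
  have q_sX : (q ^ s) ^ (f %/ s) = 1 %[mod t] by rewrite -modnXm q_s modnXm exp1n.
  by rewrite -q_f {2}(divn_eq f s) expnD (mulnC (f %/ s)%N) expnM -modnMml q_sX modnMml mul1n.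
by have := s_min _ r_gt0 q_r; rewrite leqNgt ltn_pmod.
Qed.

Lemma mult_order_inj (L : fieldType) (t q s : nat) (a : L) :
  t.-primitive_root a -> is_mult_order t q s ->
  {in [pred i | (i < s)%N] &, injective (fun i => a ^+ (q ^ i))}.
Proof.
move=> a_prim [s_gt0 q_s s_min].
have a_s : a ^+ (q ^ s) = a.
  by rewrite -(prim_expr_mod a_prim) q_s (prim_expr_mod a_prim).
have lt_inj i j : (i < j < s)%N -> a ^+ (q ^ i) != a ^+ (q ^ j).
  (* Raising to the power [q ^ (s - i)] moves a coincidence to [a = a ^+ (q ^ (j - i))], against the
     minimality of [s]. *)
  case/andP=> lt_ij lt_js; apply/eqP=> /(congr1 (fun x => x ^+ (q ^ (s - i)))).
  rewrite -!exprM -!expnD subnKC ?(ltnW (ltn_trans lt_ij lt_js)) // a_s.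
  have -> : (j + (s - i) = s + (j - i))%N by lia.
  rewrite expnD exprM a_s => a_ij.
  have : (s <= j - i)%N.
    apply: s_min; first by rewrite subn_gt0.
    by apply/eqP; rewrite -(eq_prim_root_expr a_prim) -a_ij expr1.
  by lia.
move=> i j; rewrite !inE => lt_is lt_js eq_ij.
case: (ltngtP i j) => // lt_ij.
  by have := lt_inj i j; rewrite lt_ij lt_js eq_ij eqxx => /(_ isT).
by have := lt_inj j i; rewrite lt_ij lt_is eq_ij eqxx => /(_ isT).
Qed.

Theorem proposition4p6
  (p : nat) (p_pr : prime p)
  (* K is a finite extension of Q_p *)
  (Qp : fieldType) (vp : Qp -> int) (hQp : is_padic_completion p vp)
  (K : fieldExtType Qp) (vK : K -> int) (hvK : discrete_valuation vK)
  (eK : nat) (eK_gt0 : (0 < eK)%N) (heK : ramification_index vp vK eK)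
  (* F is a finite normal extension of K; e = e(F/K) *)
  (F : splittingFieldType K) (vF : F -> int) (hvF : discrete_valuation vF)
  (e : nat) (e_gt0 : (0 < e)%N) (he : ramification_index vK vF e)
  (eF : nat) (heF : vF p%:R = eF%:Z)
  (* residue fields *)
  (kK : finFieldType) (rK : K -> kK) (hrK : residue_map vK rK)
  (kF : fieldExtType kK) (rF : F -> kF) (hrF : residue_map vF rF)
  (hrKF : forall a : K, val_ge vK 0 a -> rF a%:A = (rK a)%:A)
  (q f : nat) (hq : q = #|kK|) (hf : f = \dim {:kF})
  (* F/K is tame and split, and F contains zeta_p *)
  (tame : coprime e p)
  (tau ups : gal_of {:F})
  (hT : is_inertia vF rF <[tau]>%g)
  (hU : lifts_frobenius vF rF q ups)
  (split : (<[tau]> ><| <[ups]>)%g = 'Gal({:F} / 1)%g)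
  (zeta_p : F) (hzeta_p : p.-primitive_root zeta_p)
  (* the uniformizer pi of F' = F^<ups> (hence of F) and the root of unity zeta = tau(pi)/pi *)
  (pi : F) (pi_fix : pi \in fixedField <[ups]>%g) (pi_unif : uniformizer vF pi)
  (piK : K) (piK_unif : uniformizer vK piK) (pi_root : pi ^+ e = piK%:A)
  (zetabar : kF) (hzetabar : zetabar = rF (tau pi / pi))
  (* the modules M_i, for i >= 1 *)
  (M : nat -> representation 'F_p 'Gal({:F} / 1))
  (hM : forall i : nat, (0 < i)%N -> affords_M tau ups zetabar q i (M i))
  (* an algebraic closure of F_p *)
  (Fbar : closedFieldType) (iota : {rmorphism 'F_p -> Fbar})
  (iota_alg : integralRange iota)
  (alpha beta : Fbar) (t s : nat)
  (alpha_e : alpha ^+ e = 1) (ord_alpha : t.-primitive_root alpha)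
  (ord_q : is_mult_order t q s)
  (beta_u : beta ^+ (f %/ s) = 1)
  (* V_(alpha, beta) *)
  (V : mx_representation Fbar (<[tau]> <*> <[(ups ^+ s)%g]>)%g 1)
  (V_tau : V tau = alpha%:M) (V_ups : V (ups ^+ s)%g = beta%:M) :
  is_multiplicity
    (base_change iota
       (\big[dadd_grepr/grepr0]_(0 <= i < ((p * eF) %/ p.-1).+1 | coprime i p)
          M i))
    (ind_repr (sub_gal_full (<[tau]> <*> <[(ups ^+ s)%g]>)%g) V)
    (s * \dim {:K})%N.
Proof.
have p_gt1 := prime_gt1 p_pr.
have [phi1 [phi1_bij _ _]] := hM 1 isT.
have [fK [qE d1E dimK]] := residue_degree_exists p_pr hQp hvK eK_gt0 heK hrK hq hf phi1_bij.
have q_gt1 : (1 < q)%N by rewrite hq finNzRing_gt1.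
have fK_gt0 : (0 < fK)%N by case: (posnP fK) q_gt1 => // fK0; rewrite qE fK0.
have f_gt0 : (0 < f)%N by rewrite hf adim_gt0.
have eFE : eF = (e * eK)%N := ramification_mul p_pr hQp eK_gt0 heK e_gt0 he heF.
have p0 : p%:R = 0 :> kF := residueF_nat p_pr hQp eK_gt0 heK hvF e_gt0 he hrF.
have z_prim : e.-primitive_root zetabar.
  exact: (tame_ratio_primitive p_pr hQp hvK eK_gt0 heK hvF e_gt0 he hrK hrF hq hf
    phi1_bij tame hT hU split pi_unif pi_root hzetabar).
have tauJ : (tau ^ ups = tau ^+ q)%g.
  exact: (tame_conj p_pr hQp hvK eK_gt0 heK hvF e_gt0 he hrK hrF hq hf
    phi1_bij tame hT hU split pi_fix pi_unif pi_root hzetabar).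
(* As zeta_p lies in [F], [p.-1] divides [eF], and the bound on the exponents is exactly [p * m]. *)
have [m mE] := val_prime_cyclotomic hvF p_pr hzeta_p.
have {}mE : (p.-1 * m = e * eK)%N by rewrite -eFE; move: heF; rewrite mE => -[].
have zq (x : kF) : x ^+ (q ^ f) = x by rewrite hq hf fieldExt_expf_card.
have [s_gt0 q_s _] := ord_q.
have t_e : (t %| e)%N by rewrite (prim_order_dvd ord_alpha) alpha_e.
(* The primitive root [zetabar] lies in a field with [q ^ f] elements, so [q ^ f] is 1 modulo [e],
   hence modulo [t]. *)
have s_f : (s %| f)%N.
  apply: mult_order_dvd ord_q _; apply/eqP.
  have : q ^ f == 1 %[mod e] by rewrite -(eq_prim_root_expr z_prim) zq expr1.
  by rewrite -(modn_dvdm _ t_e) => /eqP ->; rewrite modn_dvdm.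
have alpha_q : alpha ^+ (q ^ s) = alpha.
  by rewrite -(prim_expr_mod ord_alpha) q_s (prim_expr_mod ord_alpha).
pose k : finFieldType := finvect_type kF.
have [eps0] := finField_embedding iota p_pr (p0 : p%:R = 0 :> k).
pose eps : {rmorphism kF -> Fbar} := eps0.
have epsz_prim : e.-primitive_root (eps zetabar) by rewrite fmorph_primitive_root.
(* On each [M i], [ups ^+ s] acts as the power map of exponent [q ^ s = p ^ D]. *)
pose D := (fK * s)%N.
have pD : (p ^ D = q ^ s)%N by rewrite qE -expnM.
set Y := base_change iota _.
have <- : joint_rank alpha beta (Y tau) (Y (ups ^+ s)%g) = (s * \dim {:K})%N.
  rewrite joint_rank_base_change_dadd.
  have -> : ((p * eF) %/ p.-1 = p * m)%N.
    by rewrite eFE -mE mulnCA mulKn // -subn1 subn_gt0.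
  transitivity (\sum_(0 <= i < (p * m).+1 | coprime i p)
     \sum_(l < D) ((eps zetabar ^+ i) ^+ (p ^ l) == alpha))%N.
    apply: eq_bigr => i cop_ip.
    have i_gt0 : (0 < i)%N.
      by case: i cop_ip => //; rewrite /coprime gcd0n gtn_eqF.
    have [phi [phi_bij phi_tau phi_ups]] := hM i i_gt0.
    have dE : rdegree (M i) = (fK * f)%N.
      have := card_fieldExt_additive p_pr phi_bij; rewrite -hq -hf qE -expnM.
      by move/eqP; rewrite eqn_exp2l // => /eqP.
    have [psi phiK psiK] := phi_bij.
    rewrite -rmorphXn.
    apply: (joint_rank_frobenius (k := k) (phi := phi) p_pr phiK psiK p0 iota
      eps0 (D := D) (c := zetabar ^+ i)) => //.
    - by rewrite muln_gt0 fK_gt0.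
    - by rewrite dE dvdn_pmul2l.
    - move=> x; rewrite pD.
      elim: (s) => [|n IHn]; first by rewrite repr_mx1 mulmx1.
      rewrite expnSr exprM phi_ups IHn expgSr repr_mxM ?mulmxA //.
        by rewrite groupX // (subsetP (sub_gal_full [set ups])) ?set11.
      by rewrite (subsetP (sub_gal_full [set ups])) ?set11.
    - by rewrite pD.
    by rewrite dE divnMl.
  rewrite (@tame_exponent_count _ p e eK m D (f %/ s)) // ?pD //.
  (* Here [D * eK = s * (eK * fK)], and [eK * fK] is [K : Q_p]. *)
  - by rewrite dimK /D; lia.
  - rewrite -rmorphXn /D -mulnA [(s * _)%N]mulnC divnK // expnM -qE.
    by rewrite zq.
  by rewrite divn_gt0 // dvdn_leq.
apply: (induced_multiplicity (q := q)) => //.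
- by case/sdprodP: split.
exact: mult_order_inj ord_alpha ord_q.
Qed.
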